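(* Let $F_{\alpha,\beta}=\{f^n_{\alpha(n),\beta(n)}\}_{n\in\mathbb{N}_0}$ be a Fučík system for the Neumann Laplacian on $(0,\pi)$. If the mappings $\alpha$ and $\beta$ satisfy $$\sum_{n=1}^\infty\frac{\big(\max(\sqrt{\alpha(n)},\sqrt{\beta(n)})-n\big)^2}{n^2}<\infty,$$ then $F_{\alpha,\beta}$ is a Riesz basis in $L^2(0,\pi)$.
   Context: $L^2(0,\pi)$ is the real Hilbert space with standard scalar product $\langle u,v\rangle=\int_0^\pi uv\,dx$ and norm $\|\cdot\|$; $\mathbb{N}=\{1,2,\dots\}$, $\mathbb{N}_0=\mathbb{N}\cup\{0\}$. For $n\in\mathbb{N}$ let $\Gamma_n=\{(\alpha,\beta): \alpha,\beta>0,\ \frac n2\frac{\pi}{\sqrt\alpha}+\frac n2\frac{\pi}{\sqrt\beta}=\pi\}$. For $(\alpha,\beta)\in\Gamma_n$, the normalized Fučík eigenfunction $f^n_{\alpha,\beta}$ is the $C^2$-solution of $-u''=\alpha u^+-\beta u^-$ in $(0,\pi)$, $u'(0)=u'(\pi)=0$ (where $u^\pm=\max\{\pm u,0\}$) with $f^n_{\alpha,\beta}(0)>0$ and $\sup_{[0,\pi]}|f^n_{\alpha,\beta}|=1$. Explicitly, with $l_1=\pi/\sqrt\alpha$, $l_2=\pi/\sqrt\beta$, $l=l_1+l_2=2\pi/n$, $k\in\mathbb{Z}$: if $\alpha\ge n^2\ge\beta$, then $f^n_{\alpha,\beta}(x)=\frac{\sqrt\beta}{\sqrt\alpha}\cos(\sqrt\alpha(x-kl))$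 for $kl-\frac{l_1}{2}\le x<kl+\frac{l_1}{2}$ and $f^n_{\alpha,\beta}(x)=-\cos(\sqrt\beta(x-\frac{2k+1}{2}l))$ for $\frac{2k+1}{2}l-\frac{l_2}{2}\le x<\frac{2k+1}{2}l+\frac{l_2}{2}$; if $\beta>n^2>\alpha$, then on the same intervals $f^n_{\alpha,\beta}(x)=\cos(\sqrt\alpha(x-kl))$ and $f^n_{\alpha,\beta}(x)=-\frac{\sqrt\alpha}{\sqrt\beta}\cos(\sqrt\beta(x-\frac{2k+1}{2}l))$, respectively. For $n=0$ set $f^0_{\alpha,\beta}\equiv\frac{\sqrt2}{2}$. A Fučík system is a sequence $F_{\alpha,\beta}=\{f^n_{\alpha(n),\beta(n)}\}_{n\in\mathbb{N}_0}$ where $\alpha,\beta:\mathbb{N}_0\to\mathbb{R}$ satisfy $\alpha(0)=\beta(0)=0$ and $(\alpha(n),\beta(n))\in\Gamma_n$ for every $n\ge1$. A sequence in a Hilbert space $H$ is a Riesz basis in $H$ if it is the image of a complete orthonormal system of $H$ under some linear homeomorphism of $H$. *)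

(* Defs.v *)
From HB Require Import structures.
From mathcomp Require Import all_boot all_order all_algebra.
From mathcomp Require Import sesquilinear.
From mathcomp Require Import all_classical all_reals all_analysis.
From mathcomp Require Import measurable_realfun ess_sup_inf.

Set Implicit Arguments.
Unset Strict Implicit.
Unset Printing Implicit Defensive.

Import Order.TTheory GRing.Theory Num.Theory.
Import numFieldNormedType.Exports.

Local Open Scope classical_set_scope.
Local Open Scope ring_scope.

Section Lspace_normed.
Context d (T : measurableType d) (R : realType).
Variables (mu : {measure set T -> \bar R}) (p : \bar R) (p1 : (1 <= p)%E).
Local Notation L := (LspaceType mu p1).

(* The library's Lp space comes without any algebraic structure; this section
   makes it a normed module with pointwise operations modulo a.e. equality. *)
HB.instance Definition _ := gen_eqMixin L.
HB.instance Definition _ := gen_choiceMixin L.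

Lemma eq_ae_Lnorm (f g : T -> R) :
  measurable_fun setT f -> measurable_fun setT g -> f = g %[ae mu] ->
  'N[mu]_p[EFin \o f]%E = 'N[mu]_p[EFin \o g]%E.
Proof.
move=> mf mg fg.
have mpow r (h : T -> R) : measurable_fun setT h ->
    measurable_fun setT (fun x => ((`|(EFin \o h) x|%E `^ r)%E)).
  move=> mh; apply/measurable_EFinP => /=.
  apply: (measurableT_comp (measurable_powR _)) => //.
  exact: measurableT_comp.
rewrite unlock; case: p p1 => [r _|_|].
- apply: (congr1 (fun z => z `^ r^-1)%E); apply: ae_eq_integral => //;
    [exact: mpow|exact: mpow|].
  by apply: filterS fg => x /[apply] /= ->.
- rewrite /Lnorm; case: ifPn => // _; apply: eq_ess_sup.
  by apply: filterS fg => x /(_ I) /= ->.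
- by [].
Qed.

Lemma measurable_Lspace (f : L) : measurable_fun setT (f : T -> R).
Proof. exact: (@measurable_funPT _ _ _ (measurableTypeR R) (repr _)). Qed.

Lemma Lspace_Lfun (f : L) : (f : T -> R) \in Lfun mu p.
Proof.
rewrite inE; apply/andP; split; rewrite inE /=.
  exact: measurable_Lspace.
exact: Lebesgue_finite.
Qed.

(* LspaceType uses measurableTypeR R as codomain, whose display differs from the
   one of R in {mfun T >-> R}; hence the repacking. *)
Let mfunR (f : T -> R) (fL : f \in Lfun mu p) :
    {mfun T >-> measurableTypeR R} :=
  HB.pack_for {mfun T >-> measurableTypeR R} f
    (@isMeasurableFun.Build _ _ T (measurableTypeR R) f
       (set_mem (sub_Lfun_mfun fL))).

Let cls (f : T -> R) (fL : f \in Lfun mu p) :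
    {mfun_ mu, T >-> measurableTypeR R} :=
  \pi_(@aeEqMfun _ _ R T (measurableTypeR R) mu)%qT (mfunR fL).

Let clsE (f : T -> R) (fL : f \in Lfun mu p) :
  (cls fL : T -> R) = f %[ae mu].
Proof.
have /eqP : (repr (cls fL) = mfunR fL
    %[mod @aeEqMfun _ _ R T (measurableTypeR R) mu])%qT.
  by rewrite reprK.
by rewrite eqmodE => /asboolP.
Qed.

Let cls_finite (f : T -> R) (fL : f \in Lfun mu p) : finite_norm mu p (cls fL).
Proof.
have /andP[] := fL; rewrite !inE /= => mf.
rewrite /finite_norm (@eq_ae_Lnorm (cls fL) f) //.
exact: (@measurable_funPT _ _ _ (measurableTypeR R) (repr _)).
Qed.

Definition Lclass (f : T -> R) (fL : f \in Lfun mu p) : L :=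
  HB.pack_for L (cls fL)
    (isFinLebesgue.Build d T R mu p p1 (cls fL) (cls_finite fL)).

Lemma LclassE (f : T -> R) (fL : f \in Lfun mu p) :
  (Lclass fL : T -> R) = f %[ae mu].
Proof. exact: clsE. Qed.

Lemma Lspace_eqP (f g : L) : f = g <-> (f : T -> R) = g %[ae mu].
Proof.
split=> [->|fg]; first exact: ae_eq_refl.
have : LebesgueSpace.sort f = LebesgueSpace.sort g.
  rewrite -[LHS]reprK -[RHS]reprK; apply/eqP; rewrite eqmodE.
  exact/asboolP.
case: f g {fg} => [f [[Pf]]] [g [[Pg]]] /= E.
by case: _ / E Pg => Pg; rewrite (Prop_irrelevance Pf Pg).
Qed.

Let Lfun_lin a (f g : T -> R) : f \in Lfun mu p -> g \in Lfun mu p ->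
  (fun x => a * f x + g x) \in Lfun mu p.
Proof. exact: (Lfun_submod_closed mu p1).2 a f g. Qed.

Let zero_Lfun : (fun=> 0 : R) \in Lfun mu p.
Proof. exact: (Lfun_submod_closed mu p1).1. Qed.

Let opp_Lfun (f : L) : (fun x => - f x) \in Lfun mu p.
Proof.
rewrite (_ : (fun x => - f x) = (fun x => -1 * f x + 0)).
  exact: Lfun_lin (Lspace_Lfun f) zero_Lfun.
by apply/funext => x; rewrite mulN1r addr0.
Qed.

Let add_Lfun (f g : L) : (fun x => f x + g x) \in Lfun mu p.
Proof.
rewrite (_ : (fun x => f x + g x) = (fun x => 1 * f x + g x)).
  exact: Lfun_lin (Lspace_Lfun f) (Lspace_Lfun g).
by apply/funext => x; rewrite mul1r.
Qed.

Let scale_Lfun (a : R) (f : L) : (fun x => a * f x) \in Lfun mu p.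
Proof.
rewrite (_ : (fun x => a * f x) = (fun x => a * f x + 0)).
  exact: Lfun_lin (Lspace_Lfun f) zero_Lfun.
by apply/funext => x; rewrite addr0.
Qed.

Definition Lspace_zero : L := Lclass zero_Lfun.
Definition Lspace_opp (f : L) : L := Lclass (opp_Lfun f).
Definition Lspace_add (f g : L) : L := Lclass (add_Lfun f g).
Definition Lspace_scale (a : R) (f : L) : L := Lclass (scale_Lfun a f).

Let zeroE : {ae mu, forall x, Lspace_zero x = 0}.
Proof. by apply: filterS (LclassE zero_Lfun) => x /(_ I). Qed.
Let oppE f : {ae mu, forall x, Lspace_opp f x = - f x}.
Proof. by apply: filterS (LclassE (opp_Lfun f)) => x /(_ I). Qed.
Let addE f g : {ae mu, forall x, Lspace_add f g x = f x + g x}.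
Proof. by apply: filterS (LclassE (add_Lfun f g)) => x /(_ I). Qed.
Let scaleE a f : {ae mu, forall x, Lspace_scale a f x = a * f x}.
Proof. by apply: filterS (LclassE (scale_Lfun a f)) => x /(_ I). Qed.

Let addA : associative Lspace_add.
Proof.
move=> f g h; apply/Lspace_eqP.
apply: (filterS _ (filterI (addE f (Lspace_add g h)) (filterI (addE g h)
   (filterI (addE (Lspace_add f g) h) (addE f g))))) => x [-> [-> [-> ->]]] _.
exact: addrA.
Qed.

Let addC : commutative Lspace_add.
Proof.
move=> f g; apply/Lspace_eqP.
apply: (filterS _ (filterI (addE f g) (addE g f))) => x [-> ->] _.
exact: addrC.
Qed.

Let add0 : left_id Lspace_zero Lspace_add.
Proof.
move=> f; apply/Lspace_eqP.
apply: (filterS _ (filterI (addE Lspace_zero f) zeroE)) => x [-> ->] _.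
exact: add0r.
Qed.

Let addN : left_inverse Lspace_zero Lspace_opp Lspace_add.
Proof.
move=> f; apply/Lspace_eqP.
apply: (filterS _ (filterI (addE (Lspace_opp f) f) (filterI (oppE f) zeroE)))
   => x [-> [-> ->]] _.
exact: addNr.
Qed.

HB.instance Definition _ := GRing.isZmodule.Build L addA addC add0 addN.

Let scaleA a b f :
  Lspace_scale a (Lspace_scale b f) = Lspace_scale (a * b) f.
Proof.
apply/Lspace_eqP.
apply: (filterS _ (filterI (scaleE a (Lspace_scale b f))
   (filterI (scaleE b f) (scaleE (a * b) f)))) => x [-> [-> ->]] _.
exact: mulrA.
Qed.

Let scale1 : left_id 1 Lspace_scale.
Proof.
move=> f; apply/Lspace_eqP.
apply: (filterS _ (scaleE 1 f)) => x -> _.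
exact: mul1r.
Qed.

Let scaleDr : right_distributive Lspace_scale +%R.
Proof.
move=> a f g; apply/Lspace_eqP.
apply: (filterS _ (filterI (scaleE a (Lspace_add f g)) (filterI (addE f g)
   (filterI (addE (Lspace_scale a f) (Lspace_scale a g))
   (filterI (scaleE a f) (scaleE a g)))))) => x [-> [-> [-> [-> ->]]]] _.
exact: mulrDr.
Qed.

Let scaleDl f : {morph Lspace_scale^~ f : a b / a + b}.
Proof.
move=> a b; apply/Lspace_eqP.
apply: (filterS _ (filterI (scaleE (a + b) f)
   (filterI (addE (Lspace_scale a f) (Lspace_scale b f))
   (filterI (scaleE a f) (scaleE b f))))) => x [-> [-> [-> ->]]] _.
exact: mulrDl.
Qed.

HB.instance Definition _ :=
  GRing.Zmodule_isLmodule.Build R L scaleA scale1 scaleDr scaleDl.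

Lemma LspaceDE (f g : L) : {ae mu, forall x, (f + g : L) x = f x + g x}.
Proof. exact: addE. Qed.

Lemma LspaceNE (f : L) : {ae mu, forall x, (- f : L) x = - f x}.
Proof. exact: oppE. Qed.

Lemma LspaceZE a (f : L) : {ae mu, forall x, (a *: f : L) x = a * f x}.
Proof. exact: scaleE. Qed.

Lemma Lspace0E : {ae mu, forall x, (0 : L) x = 0}.
Proof. exact: zeroE. Qed.

Definition Lspace_norm (f : L) : R := fine ('N[mu]_p[EFin \o f])%E.

Let norm_class (f : L) (g : LfunType mu p1) : (f : T -> R) = g %[ae mu] ->
  Lspace_norm f = fine ('N[mu]_p[EFin \o g])%E.
Proof.
move=> fg; congr fine; apply: eq_ae_Lnorm => //.
exact: measurable_Lspace.
Qed.

Let normD (f g : L) : Lspace_norm (f + g) <= Lspace_norm f + Lspace_norm g.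
Proof.
pose f' := Lfun_Sub p1 (Lspace_Lfun f).
pose g' := Lfun_Sub p1 (Lspace_Lfun g).
rewrite (@norm_class (f + g) (f' + g')).
  exact: (ler_LnormD f' g').
by apply: (filterS _ (LspaceDE f g)) => x ->.
Qed.

Let normZ a (f : L) : Lspace_norm (a *: f) = `|a| * Lspace_norm f.
Proof.
pose f' := Lfun_Sub p1 (Lspace_Lfun f).
rewrite (@norm_class (a *: f) (a *: f')); last first.
  by apply: (filterS _ (LspaceZE a f)) => x ->.
apply: EFin_inj; rewrite EFinM !finite_norm_fine.
rewrite (finite_norm_fine f').
exact: (LnormZ f' a).
Qed.

Let norm0_eq0 (f : L) : Lspace_norm f = 0 -> f = 0.
Proof.
pose f' := Lfun_Sub p1 (Lspace_Lfun f).
move=> /(@fine_Lnormr_eq0 _ _ _ _ _ _ f') f0.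
apply/Lspace_eqP.
by apply: (filterS _ (filterI f0 Lspace0E)) => x [/(_ I) fx0 ->] _.
Qed.

HB.instance Definition _ :=
  Lmodule_isNormed.Build R L normD normZ norm0_eq0.

Lemma Lspace_normE (f : L) : `|f| = fine ('N[mu]_p[EFin \o f])%E.
Proof. by []. Qed.

End Lspace_normed.

Section L2_dot.
Context d (T : measurableType d) (R : realType).
Variable mu : {measure set T -> \bar R}.
Local Notation L := (LspaceType mu (lee1n 2)).

Definition L2dot (f g : L) : R := \int[mu]_x (f x * g x).

Lemma L2dot_integrable (f g : L) :
  mu.-integrable setT (EFin \o (fun x => f x * g x)).
Proof.
apply/Lfun1_integrable.
exact: (Lfun2_mul_Lfun1 (Lspace_Lfun f) (Lspace_Lfun g)).
Qed.

Lemma L2dotC (f g : L) : L2dot f g = L2dot g f.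
Proof. by apply: eq_Rintegral => x _; rewrite mulrC. Qed.

Lemma L2dot_linear (g : L) : GRing.linear_for *%R (L2dot ^~ g).
Proof.
move=> a f h; rewrite /L2dot.
have ifg := L2dot_integrable f g; have ihg := L2dot_integrable h g.
rewrite -RintegralZl // -RintegralD //; last first.
  have := @integrableZl _ T R mu setT measurableT a _ ifg.
  by apply: eq_integrable => // x _; rewrite /= EFinM.
congr fine; apply: ae_eq_integral => //.
- exact: (measurable_int mu (L2dot_integrable (a *: f + h) g)).
- apply/measurable_EFinP; apply: measurable_funD.
    by apply: measurable_funM => //; apply/measurable_EFinP;
       exact: (measurable_int mu ifg).
  by apply/measurable_EFinP; exact: (measurable_int mu ihg).
- apply: (filterS _ (filterI (LspaceDE (a *: f) h) (LspaceZE a f))).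
  by move=> x [-> ->] _; rewrite mulrDl mulrA.
Qed.

Lemma L2dot_bilinear : bilinear_for *%R (idfun \; *%R) L2dot.
Proof.
split=> [g|f]; first exact: L2dot_linear.
by move=> a g h /=; rewrite L2dotC L2dot_linear !(L2dotC f).
Qed.

HB.instance Definition _ := bilinear_isBilinear.Build R L L R
  *%R (idfun \; *%R) L2dot L2dot_bilinear.

Lemma L2dot_hermitian (f g : L) :
  L2dot f g = (-1) ^+ false * idfun (L2dot g f).
Proof. by rewrite expr0 mul1r L2dotC. Qed.

HB.instance Definition _ :=
  isHermitianSesquilinear.Build R L false idfun L2dot L2dot_hermitian.

Lemma L2norm_dot (f : L) : `|f| ^+ 2 = L2dot f f.
Proof.
rewrite Lspace_normE -powR_mulrn ?fine_ge0 ?Lnorm_ge0 //.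
apply: EFin_inj; rewrite -poweR_EFin.
rewrite (finite_norm_fine (Lfun_Sub (lee1n 2) (Lspace_Lfun f))).
rewrite powR_Lnorm // /L2dot /Rintegral fineK; last first.
  exact: (integrable_fin_num _ (L2dot_integrable f f)).
apply: eq_integral => x _ /=.
by rewrite powR_mulrn // real_normK ?num_real // expr2.
Qed.

Lemma L2dot_gt0 (f : L) : f != 0 -> 0 < L2dot f f.
Proof. by move=> f0; rewrite -L2norm_dot exprn_gt0 // normr_gt0. Qed.

HB.instance Definition _ := isDotProduct.Build R L L2dot L2dot_gt0.

End L2_dot.

Section riesz_basis.
Context (R : realType) (H : normedModType R) (dot : {dot H for idfun}).
Implicit Types e f : nat -> H.

Definition orthonormal_seq e := forall i j, dot (e i) (e j) = (i == j)%:R.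

Definition complete_seq e :=
  closure [set v | exists n (c : nat -> R), v = \sum_(i < n) c i *: e i] = setT.

Definition homeomorphism (S : H -> H) :=
  continuous S /\
  exists S', [/\ cancel S S', cancel S' S & continuous S'].

(* The topology is that of the norm of H, to be used only when that norm is the
   one induced by dot; for L2dot this is L2norm_dot. *)
Definition riesz_basis f :=
  exists e (S : {linear H -> H}),
    [/\ orthonormal_seq e, complete_seq e, homeomorphism S &
        forall n, f n = S (e n)].

End riesz_basis.

Section fucik.
Variable R : realType.
Implicit Types (a b : R) (u : R -> R) (alpha beta : nat -> R).

(* L^2(0, pi) is modelled by functions on R modulo equality a.e. on ]0, pi[. *)
Definition lebesgue_0pi : {measure set (measurableTypeR R) -> \bar R} :=
  mrestr lebesgue_measure (measurable_itv `]0, pi[).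

Definition L2_0pi := LspaceType lebesgue_0pi (lee1n 2).

Definition fucik_Gamma (n : nat) a b :=
  [/\ 0 < a, 0 < b &
      n%:R / 2 * (pi / Num.sqrt a) + n%:R / 2 * (pi / Num.sqrt b) = pi].

(* u is only meaningful on [0, pi], so the Neumann conditions are about the
   one-sided derivatives at 0 and pi. *)
Definition fucik_solution a b u :=
  [/\ forall x, x \in `]0, pi[ ->
        [/\ derivable u x 1, derivable (derive1 u) x 1,
            {for x, continuous (derive1 (derive1 u))} &
            - derive1 (derive1 u) x = a * u^\+ x - b * u^\- x],
      h^-1 * (u h - u 0) @[h --> 0^'+] --> 0 &
      h^-1 * (u (pi + h) - u pi) @[h --> 0^'-] --> 0].

Definition fucik_eigenfunction (n : nat) a b u :=
  if n is 0 then forall x, x \in `[0, pi] -> u x = Num.sqrt 2 / 2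
  else [/\ fucik_solution a b u, 0 < u 0 &
           sup [set `|u x| | x in `[0, pi]] = 1].

Definition fucik_system alpha beta (F : nat -> L2_0pi) :=
  [/\ alpha 0%N = 0, beta 0%N = 0,
      forall n, (0 < n)%N -> fucik_Gamma n (alpha n) (beta n) &
      forall n, exists2 u, fucik_eigenfunction n (alpha n) (beta n) u &
        (F n : R -> R) = u %[ae lebesgue_0pi]].

End fucik.

(* Main.v *)
Require Import Defs.
From HB Require Import structures.
From mathcomp Require Import all_boot all_order all_algebra.
From mathcomp Require Import all_classical all_reals all_analysis.
From mathcomp Require Import measurable_realfun sesquilinear ring lra.

Set Implicit Arguments.
Unset Strict Implicit.
Unset Printing Implicit Defensive.

Import Order.TTheory GRing.Theory Num.Theory.
Import numFieldNormedType.Exports.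

Local Open Scope classical_set_scope.
Local Open Scope ring_scope.

(* The Neumann setting makes f^n even about 0 and 2 pi / n-periodic, that is
   f^n(x) = h (acos (cos (n x))) for a decreasing function h on [0, pi].  Hence
   f^n only involves the frequencies 0, n, 2n, ... of the cosine basis e, its
   n-th coefficient does not vanish, and |f^n(x) - cos (n x)| is bounded by a
   multiple of max (sqrt alpha(n)) (sqrt beta(n)) / n - 1.  The last bound and
   the hypothesis give sum_n ||f^n - c e_n||^2 < oo with c = sqrt (pi / 2), so
   replacing a tail of c e by the corresponding tail of f amounts to an operator
   1 + K with ||K|| <= 1 / 2.  The remaining vectors are exchanged one by one,
   from higher to lower index; each exchange is a rank-one perturbation, which
   is invertible thanks to the triangularity above. *)

(** * Triangular perturbations of orthonormal bases *)

(** Square-summable closeness controls only a tail: finitely many early f^n may be far from cos (n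
    x), and no smallness argument reaches those. Exchanging downwards means that when e_m is
    replaced, only vectors of index above m have been changed, and these have no component along e_m
    for m > 0; invertibility then depends on the m-th coordinate of f^m alone. Column 0 escapes
    triangularity, since every f^n may have a nonzero mean, but f^0 needs no exchange: c = sqrt (pi
    / 2) makes c e_n equal to cos (n x) for n >= 1 and c e_0 equal to sqrt 2 / 2, which is f^0
    itself. No Fourier coefficient of f^n is computed. The vanishing below n comes from
    approximating h (acos (cos t)) uniformly by cosine polynomials and setting t = n x; the same
    approximation gives completeness of the cosines. Nonvanishing at n is a sign argument. Since f^n
    is given by a boundary value problem, its shape rests on uniqueness for the piecewise linear
    equation. *)

Lemma lipschitz_continuous (R : realType) (V W : normedModType R) (T : V -> W) (C : R) :
  (forall x y, `|T x - T y| <= C * `|x - y|) -> continuous T.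
Proof.
move=> TC x; apply/cvgrPdist_lt => eps eps0.
have C0 : 0 < `|C| + 1 by rewrite ltr_wpDl.
near=> y.
have xy : `|x - y| < eps / (`|C| + 1).
  by near: y; apply: cvgr_dist_lt; rewrite ?divr_gt0.
apply: (le_lt_trans (TC x y)).
rewrite ltr_pdivlMr // mulrC in xy; apply: le_lt_trans xy.
by rewrite ler_wpM2r // (le_trans (ler_norm C)) // lerDl.
Unshelve. all: by end_near. Qed.

Lemma min_lipschitz (R : realDomainType) (a s t : R) :
  `|Num.min s a - Num.min t a| <= `|s - t|.
Proof.
rewrite ler_norml; have := ler_norm (s - t); have := ler_norm (t - s).
rewrite distrC; have := normr_ge0 (s - t); move: `|s - t| => z.
by case: (leP s a) => ?; case: (leP t a) => ? ? ? ?; apply/andP; split; lra.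
Qed.

Lemma max_lipschitz (R : realDomainType) (a s t : R) :
  `|Num.max s a - Num.max t a| <= `|s - t|.
Proof.
rewrite ler_norml; have := ler_norm (s - t); have := ler_norm (t - s).
rewrite distrC; have := normr_ge0 (s - t); move: `|s - t| => z.
by case: (leP s a) => ?; case: (leP t a) => ? ? ? ?; apply/andP; split; lra.
Qed.

Section linear_functions.
Context (R : pzRingType) (V W : lmodType R) (f : V -> W).
Hypothesis linf : linear f.

Lemma linear_funD : {morph f : x y / x + y}.
Proof. by move=> x y; have := linf 1 x y; rewrite !scale1r. Qed.

Lemma linear_fun0 : f 0 = 0.
Proof. by apply: (addrI (f 0)); rewrite -linear_funD !addr0. Qed.

Lemma linear_funZ (a : R) x : f (a *: x) = a *: f x.
Proof. by have := linf a x 0; rewrite linear_fun0 !addr0. Qed.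

Lemma linear_funN : {morph f : x / - x}.
Proof. by move=> x; rewrite -scaleN1r linear_funZ scaleN1r. Qed.

End linear_functions.

Section abstract_riesz.
Context (R : realType) (H : normedModType R) (dot : {dot H for idfun}).
Implicit Types (x y w : H) (e d f u : nat -> H) (T : H -> H).

Lemma dot_sym x y : dot x y = dot y x.
Proof. by rewrite hermC expr0 mul1r. Qed.

Lemma dot_scalel (a : R) x y : dot (a *: x) y = a * dot x y.
Proof. exact: linearZl_LR. Qed.

Lemma dot_addl x y z : dot (x + y) z = dot x z + dot y z.
Proof. exact: linearDl. Qed.

Lemma dot_subl x y z : dot (x - y) z = dot x z - dot y z.
Proof. exact: linearBl. Qed.

Lemma dot_subr x y z : dot x (y - z) = dot x y - dot x z.
Proof. exact: linearBr. Qed.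

Lemma dot_sumr n (F : 'I_n -> H) x :
  dot x (\sum_(i < n) F i) = \sum_(i < n) dot x (F i).
Proof. exact: linear_sumr. Qed.

Lemma dot_scaler (a : R) x y : dot x (a *: y) = a * dot x y.
Proof. by rewrite dot_sym dot_scalel dot_sym. Qed.

Hypothesis normE : forall x, `|x| ^+ 2 = dot x x.

Lemma dot_cauchy_schwarz x y : `|dot x y| <= `|x| * `|y|.
Proof.
have [->|y0] := eqVneq y 0; first by rewrite linear0r !normr0 mulr0.
have yy0 : 0 < dot y y by rewrite -normE exprn_gt0 ?normr_gt0.
rewrite -(@ler_pXn2r _ 2) ?nnegrE ?mulr_ge0 // real_normK ?num_real //.
rewrite exprMn !normE.
have := sqr_ge0 `|x - (dot x y / dot y y) *: y|.
rewrite normE dot_subl !dot_subr !dot_scalel !dot_scaler (dot_sym y x).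
set a := dot x x; set b := dot x y; set c := dot y y.
have -> : a - b / c * b - (b / c * b - b / c * (b / c * c)) = a - b ^+ 2 / c.
  by field; rewrite gt_eqF.
by rewrite subr_ge0 ler_pdivrMr.
Qed.

Lemma bessel e x n : orthonormal_seq dot e ->
  \sum_(i < n) dot x (e i) ^+ 2 <= `|x| ^+ 2.
Proof.
move=> eO; pose s := \sum_(i < n) dot x (e i) *: e i.
have sE y : dot y s = \sum_(i < n) dot x (e i) * dot y (e i).
  by rewrite /s dot_sumr; apply: eq_bigr => i _; exact: dot_scaler.
have xs : dot x s = \sum_(i < n) dot x (e i) ^+ 2 by rewrite sE.
have ss : dot s s = \sum_(i < n) dot x (e i) ^+ 2.
  rewrite sE; apply: eq_bigr => i _.
  rewrite (dot_sym s) sE (bigD1 i) //= big1 ?addr0 => [|j ji].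
    by rewrite eO eqxx mulr1 expr2.
  by rewrite eO eq_sym val_eqE (negbTE ji) mulr0.
have := sqr_ge0 `|x - s|.
by rewrite (normE (x - s)) dot_subl !dot_subr (dot_sym s x) xs ss subrr subr0 -normE subr_ge0.
Qed.

Lemma dot_continuous v : continuous (fun x => dot x v : R^o).
Proof.
apply: (@lipschitz_continuous _ _ _ _ `|v|) => x y.
by rewrite -dot_subl mulrC dot_cauchy_schwarz.
Qed.

(** The Sherman-Morrison formula: the inverse is y |-> S y - (dot (S y) v / th) S w with th = 1 +
    dot (S w) v. The hypothesis quantifies over the inverse [S] because [homeomorphism] only asserts
    that one exists. *)
Lemma homeomorphism_rank_one T e w : linear T -> homeomorphism T ->
  forall v, (forall S, cancel T S -> cancel S T -> 1 + dot (S w) v != 0) ->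
  homeomorphism (fun x => T x + dot x v *: w).
Proof.
move=> linT [cT [S [TK SK cS]]] v; move=> /(_ S TK SK).
set th := 1 + _ => th0.
have linS : linear S.
  by move=> a x y; apply: (can_inj TK); rewrite SK linT !SK.
have SD := linear_funD linS; have SZ := linear_funZ linS.
have TD := linear_funD linT; have TZ := linear_funZ linT.
split.
  move=> x; apply: cvgD; first exact: cT.
  by apply: cvgZr_tmp; exact: dot_continuous.
exists (fun y => S y - (dot (S y) v / th) *: S w); split.
- move=> x; rewrite SD TK SZ dot_addl dot_scalel.
  rewrite (_ : (_ + _) / th = dot x v) ?addrK //.
  by rewrite -[X in X + _]mulr1 -mulrDr mulfK.
- move=> y; rewrite -scaleNr TD TZ !SK dot_addl dot_scalel.
  rewrite -addrA -scalerDl.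
  have dSw : dot (S w) v = th - 1 by rewrite /th addrC addKr.
  have -> : - (dot (S y) v / th) +
      (dot (S y) v + - (dot (S y) v / th) * dot (S w) v) = 0.
    by rewrite dSw; field.
  by rewrite scale0r addr0.
- move=> x; apply: cvgB; first exact: cS.
  apply: cvgZr_tmp; apply: cvgMr_tmp.
  by apply: (@cvg_comp _ _ _ S (fun z => dot z v)); [exact: cS|exact: dot_continuous].
Qed.

(** Completeness of [H], stated as convergence of absolutely convergent series. *)
Hypothesis absolutely_cvg : forall u,
  cvgn (series (fun n => `|u n|)) -> cvgn (series u).

(** The Neumann series of the terms (-K)^j y provides a right inverse. That it is also a left
    inverse, and Lipschitz, follows from the lower bound |x - y| <= 2 |T x - T y|, a consequence of
    |K x| <= |x| / 2. *)
Lemma homeomorphism_neumann (K : H -> H) : linear K ->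
  (forall x, `|K x| <= `|x| / 2) -> homeomorphism (fun x => x + K x).
Proof.
move=> linK K2; pose T x := x + K x.
have KD := linear_funD linK; have KN := linear_funN linK.
have Tlip x y : `|T x - T y| <= 2 * `|x - y|.
  rewrite /T opprD addrACA -KN -KD (le_trans (ler_normD _ _)) //.
  have := K2 (x - y); have := normr_ge0 (x - y); lra.
have cT : continuous T by exact: lipschitz_continuous Tlip.
have Tinj x y : `|x - y| <= 2 * `|T x - T y|.
  rewrite /T opprD addrACA -KN -KD.
  have := lerB_normD (x - y) (K (x - y)).
  have := K2 (x - y); have := normr_ge0 (x - y); lra.
pose u y j := iter j (fun x => - K x) y.
have uE y j : `|u y j| <= `|y| * 2^-1 ^+ j.
  elim: j => [|j IH]; first by rewrite expr0 mulr1.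
  rewrite /u /= normrN -/(u y j) (le_trans (K2 _)) // exprS mulrCA mulrC.
  by rewrite ler_pM2l.
have cvgu y : cvgn (series (u y)).
  apply: absolutely_cvg; apply: (@series_le_cvg _ _ (geometric `|y| 2^-1)) => //.
  - by move=> n; rewrite mulr_ge0 // exprn_ge0.
  - by apply: is_cvg_geometric_series; rewrite ger0_norm // invf_lt1 // ltr1n.
pose S y := limn (series (u y)).
have TS : cancel S T.
  move=> y; apply: (@cvg_unique _ (@norm_hausdorff _ H) (T (series (u y) n) @[n --> \oo])).
    by apply: continuous_cvg; [exact: cT|exact: cvgu].
  (* Telescoping: T maps the sum of the first n terms (-K)^j y to y minus the n-th term. *)
  have -> : (fun n => T (series (u y) n)) = (fun n => y - u y n).
    apply/funext; elim => [|n IH]; rewrite /T.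
      by rewrite /series /= big_geq // (linear_fun0 linK) addr0 subrr.
    rewrite seriesSr KD addrACA [_ + K (series _ _)]IH /= -/(u y n).
    by rewrite opprK addrA subrK.
  suff : y - u y n @[n --> \oo] --> y - 0 by rewrite subr0.
  apply: cvgB; first exact: cvg_cst.
  exact: cvg_series_cvg_0.
have ST : cancel T S.
  move=> x; apply/eqP; rewrite -subr_eq0 -normr_le0.
  by rewrite (le_trans (Tinj _ _)) // TS subrr normr0 mulr0.
split=> //; exists S; split=> //.
apply: (@lipschitz_continuous _ _ _ _ 2) => x y.
by rewrite (le_trans (Tinj _ _)) // !TS.
Qed.

(** The operator is 1 + K, where K x is the series of dot x (e i) *: d i; the bound 1/4 is what
    yields |K x| <= |x| / 2. A vector orthogonal to every [d n] is orthogonal to the range of K,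
    whence the last clause. *)
Lemma homeomorphism_tail e d : orthonormal_seq dot e ->
  (forall n, \sum_(i < n) `|d i| ^+ 2 <= 4^-1) ->
  exists T, [/\ linear T, homeomorphism T, forall n, T (e n) = e n + d n &
   forall x y, (forall n, dot (d n) y = 0) -> dot (T x) y = dot x y].
Proof.
move=> eO d4; pose u x i := dot x (e i) *: d i.
have sum_le x n : \sum_(i < n) `|u x i| <= `|x| / 2.
  have [->|x0] := eqVneq x 0.
    rewrite big1 ?normr0 ?mul0r // => i _.
    by rewrite /u linear0l scale0r normr0.
  have nx0 : 0 < `|x| by rewrite normr_gt0.
  (* Young's inequality a b <= a^2 / (4 |x|) + |x| b^2, weighted so that Bessel's inequality and the
     bound on [d] contribute |x| / 4 each. *)
  apply: (@le_trans _ _ (\sum_(i < n) ((4 * `|x|)^-1 * dot x (e i) ^+ 2 +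
      `|x| * `|d i| ^+ 2))).
    apply: ler_sum => i _; rewrite /u normrZ -[dot x _ ^+ 2]real_normK ?num_real //.
    set a := `|dot _ _|; set b := `|d i|; rewrite -subr_ge0.
    rewrite (_ : _ - _ = (2 * `|x| * b - a) ^+ 2 / (4 * `|x|)).
      by rewrite divr_ge0 ?sqr_ge0 // mulr_ge0.
    by field; rewrite gt_eqF.
  rewrite big_split /= -!mulr_sumr.
  apply: (@le_trans _ _ ((4 * `|x|)^-1 * `|x| ^+ 2 + `|x| * 4^-1)).
    apply: lerD; rewrite ler_wpM2l ?invr_ge0 ?mulr_ge0 //.
    - exact: bessel.
    - exact: d4.
  rewrite le_eqVlt; apply/orP; left; apply/eqP.
  by field; rewrite gt_eqF.
have cvgu x : cvgn (series (u x)).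
  apply: absolutely_cvg; apply: nondecreasing_is_cvgn.
    by apply: nondecreasing_series => n _ _.
  by exists (`|x| / 2) => _ [n _ <-]; rewrite /series /= big_mkord.
pose K x := limn (series (u x)).
have linK : linear K.
  move=> a x y; apply/cvg_lim; first exact: norm_hausdorff.
  have -> : series (u (a *: x + y)) =
      (fun n => a *: series (u x) n + series (u y) n).
    apply/funext => n; rewrite /series /= scaler_sumr -big_split /=.
    apply: eq_bigr => i _.
    by rewrite /u dot_addl dot_scalel scalerDl scalerA.
  by apply: cvgD; [apply: cvgZl_tmp|]; exact: cvgu.
have K2 x : `|K x| <= `|x| / 2.
  rewrite /K -lim_norm //; apply: limr_le; first exact: is_cvg_norm.
  apply: nearW => n; rewrite (le_trans (ler_norm_sum _ _ _)) //.
  by rewrite big_mkord.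
exists (fun x => x + K x); split.
- by move=> a x y; rewrite linK scalerDr addrACA.
- exact: homeomorphism_neumann.
- move=> n; congr (_ + _); apply/cvg_lim; first exact: norm_hausdorff.
  apply: cvg_near_cst; exists n.+1 => // m /= nm; rewrite /series /=.
  rewrite big_mkord (bigD1 (Ordinal nm)) //= big1 ?addr0 => [|i].
    by rewrite /u eO eqxx scale1r.
  rewrite -val_eqE /= => im.
  by rewrite /u eO eq_sym (negbTE im) scale0r.
- move=> x y dy; rewrite dot_addl [dot (K x) y](_ : _ = 0) ?addr0 //.
  apply: (@cvg_unique _ (@Rhausdorff R) (dot (series (u x) n) y @[n --> \oo])).
    have h2 := @dot_continuous y (K x).
    have h1 : series (u x) n @[n --> \oo] --> K x by exact: cvgu.
    exact: (cvg_comp _ _ h1 h2).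
  apply: cvg_near_cst; apply: nearW => n.
  rewrite dot_sym /series /= big_mkord dot_sumr big1 // => i _.
  by rewrite /u dot_scaler (dot_sym y) dy mulr0.
Qed.

(* Triangularity keeps every rank-one correction invertible: the coordinates
   below k are not affected by the vectors replaced so far, so adding
   f k - e k only rescales the k-th coordinate by dot (f k) (e k). *)
Lemma triangular_homeomorphism e f (N : nat) : orthonormal_seq dot e ->
  (forall n k, (0 < k < n)%N -> dot (f n) (e k) = 0) ->
  (forall n, (0 < n)%N -> dot (f n) (e n) != 0) -> f 0%N = e 0%N ->
  (forall n, \sum_(N <= i < n) `|f i - e i| ^+ 2 <= 4^-1) ->
  exists T, [/\ linear T, homeomorphism T & forall n, T (e n) = f n].
Proof.
move=> eO f0 fn0 f0e0 fe.
(* [k] counts the exchanges made below [N]; the last clause is the invariant on which the next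
   exchange relies. *)
suff main k : (k <= N)%N -> exists T, [/\ linear T, homeomorphism T,
    forall n, T (e n) = if (N - k <= n)%N then f n else e n &
    forall x j, (0 < j < N - k)%N -> dot (T x) (e j) = dot x (e j)].
  have [T [linT hT Te _]] := main N (leqnn N).
  by exists T; split=> // n; rewrite Te subnn.
elim: k => [_|k IH kN].
  rewrite subn0.
  have [n|T [linT hT Te Tj]] :=
    @homeomorphism_tail e (fun n => if (N <= n)%N then f n - e n else 0) eO.
    have [Nn|nN] := leqP N n; last first.
      by rewrite big1 ?invr_ge0 // => i _; rewrite leqNgt (ltn_trans _ nN) //= normr0 expr0n.
    apply: le_trans (fe n); rewrite -(big_mkord xpredT
      (fun i => `|if (N <= i)%N then f i - e i else 0| ^+ 2)).
    rewrite (big_cat_nat _ Nn) //= big_nat big1 ?add0r => [|i /andP[_ iN]].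
      by rewrite le_eqVlt; apply/orP; left; apply/eqP; apply: eq_big_nat => i /andP[->].
    by rewrite leqNgt iN /= normr0 expr0n.
  exists T; split=> //.
    by move=> n; rewrite Te; case: ifP => _; rewrite ?addr0 // addrC subrK.
  move=> x j /andP[j0 jN]; apply: Tj => n; case: ifPn => [Nn|_]; last exact: linear0l.
  have jn := leq_trans jN Nn.
  by rewrite dot_subl f0 ?j0 // eO gtn_eqF // subrr.
have [T [linT hT Te Tj]] := IH (ltnW kN).
set m := (N - k.+1)%N.
have mS : (N - k = m.+1)%N by rewrite /m -subSn // subSS.
rewrite mS in Te Tj.
have Tm : (0 < m)%N -> forall x, dot (T x) (e m) = dot x (e m).
  by move=> m0 x; apply: Tj; rewrite m0 ltnS leqnn.
exists (fun x => T x + dot x (e m) *: (f m - e m)); split.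
- move=> a x y /=; rewrite linT dot_addl dot_scalel.
  move: (f m - e m) => w.
  by rewrite scalerDl scalerDr scalerA addrACA.
- apply: homeomorphism_rank_one => // S TS ST.
  (* Triangularity says nothing about coordinate 0, but there f 0 = e 0 makes the correction
     vanish. *)
  have [m0|m0] := posnP m.
    rewrite m0 f0e0 subrr (_ : S 0 = 0) ?linear0l ?addr0 ?oner_eq0 //.
    by apply: (can_inj TS); rewrite ST (linear_fun0 linT).
  (* T preserves the m-th coordinate, so that of S w is the one of w, namely dot (f m) (e m) - 1;
     the denominator is therefore dot (f m) (e m). *)
  by rewrite -Tm // ST dot_subl eO eqxx addrCA subrr addr0 fn0.
- move=> n; rewrite Te eO; have [->|nm] := eqVneq n m.
    by rewrite ltnn leqnn scale1r addrC subrK.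
  by rewrite scale0r addr0 ltn_neqAle eq_sym nm.
- move=> x j /andP[j0 jm].
  rewrite dot_addl Tj ?j0 ?ltnS ?(ltnW jm) // dot_scalel dot_subl.
  by rewrite f0 ?j0 // eO gtn_eqF // subrr mulr0 addr0.
Qed.

Theorem riesz_basis_triangular e f (c : R) : c != 0 ->
  orthonormal_seq dot e -> complete_seq e ->
  (forall n k, (0 < k < n)%N -> dot (f n) (e k) = 0) ->
  (forall n, (0 < n)%N -> dot (f n) (e n) != 0) -> f 0%N = c *: e 0%N ->
  cvgn (series (fun n => `|f n - c *: e n| ^+ 2)) ->
  riesz_basis dot f.
Proof.
move=> c0 eO eC f0 fn0 f0e0 cvgfe.
have c20 : 0 < c ^+ 2 by rewrite exprn_even_gt0.
have [N Nfe] : exists N, forall n,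
    \sum_(N <= i < n) `|c^-1 *: f i - e i| ^+ 2 <= 4^-1.
  (* The threshold becomes 1/4 once the vectors are divided by [c]. *)
  have eps0 : 0 < c ^+ 2 / 4 by rewrite divr_gt0.
  have /cauchy_cvgP/cauchy_seriesP/(_ _ eps0) := cvgfe.
  case=> -[A B] /= [[NA _ HA] [NB _ HB]] AB.
  exists (maxn NA NB) => n; have [nN|Nn] := leqP n (maxn NA NB).
    by rewrite big_geq ?invr_ge0.
  have := AB (maxn NA NB, n); rewrite /= => /(_ (conj _ _)).
  move=> /(_ (HA _ (leq_maxl _ _)) (HB _ (leq_trans (leq_maxr _ _) (ltnW Nn)))).
  rewrite ger0_norm ?sumr_ge0 // => /ltW.
  rewrite -ler_pdivrMl // mulr_sumr; apply: le_trans.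
  rewrite le_eqVlt; apply/orP; left; apply/eqP; apply: eq_bigr => i _.
  rewrite -[in RHS](scalerKV c0 (f i)) -scalerBr normrZ exprMn real_normK ?num_real //.
  by rewrite mulKf // gt_eqF.
have [|||//|T [linT [cT [S [TS ST cS]]] Te]] :=
  @triangular_homeomorphism e (fun n => c^-1 *: f n) N eO.
- by move=> n k kn; rewrite dot_scalel f0 // mulr0.
- by move=> n n0; rewrite dot_scalel mulf_neq0 ?invr_eq0 ?fn0.
- by rewrite f0e0 scalerK.
have linS : linear (fun x => c *: T x).
  by move=> a x y; rewrite linT scalerDr !scalerA mulrC.
pose cT' := HB.pack_for {linear H -> H} (fun x => c *: T x)
  (GRing.isLinear.Build R H H *:%R (fun x => c *: T x) linS).
exists e, cT'; split=> //.
- split; first by move=> x; apply: cvgZl_tmp; exact: cT.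
  exists (fun y => S (c^-1 *: y)); split.
  + by move=> x /=; rewrite scalerK // TS.
  + by move=> x /=; rewrite ST scalerKV.
  + move=> x; apply: (@continuous_comp _ _ _ (fun y => c^-1 *: y) S).
      by apply: cvgZl_tmp; exact: cvg_id.
    exact: cS.
- by move=> n /=; rewrite Te scalerKV.
Qed.

End abstract_riesz.
(** * Uniform approximation by cosine polynomials *)

Section weierstrass.
Context (R : realType).
Implicit Types (g h : nat -> R) (f F G : R -> R) (x y t : R).

(* Pascal's rule makes this the Bernstein operator
   \sum_(k <= m) 'C(m, k) y ^ k (1 - y) ^ (m - k) g k. *)
Fixpoint bernstein (m : nat) g y : R :=
  if m is m'.+1 then (1 - y) * bernstein m' g y + y * bernstein m' (g \o S) y
  else g 0%N.

Lemma bernstein_le m g h y : 0 <= y <= 1 ->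
  (forall k, (k <= m)%N -> g k <= h k) -> bernstein m g y <= bernstein m h y.
Proof.
move=> /andP[y0 y1]; elim: m g h => [|m IH] g h gh /=; first exact: gh.
apply: lerD; apply: ler_wpM2l; rewrite ?subr_ge0 //; apply: IH => k km.
  by apply: gh; rewrite (leq_trans km).
exact: gh.
Qed.

Lemma bernstein_affine m (a b : R) g y :
  bernstein m (fun k => a * g k + b) y = a * bernstein m g y + b.
Proof.
elim: m g => [//|m IH] g /=.
by rewrite IH (IH (g \o S)); ring.
Qed.

(** The second moment of the binomial law about an arbitrary centre [c]: the shift [g \o S] in the
    recursion replaces c by c - 1, so the mean m y alone would not support the induction. *)
Lemma bernstein_variance m (c : R) y :
  bernstein m (fun k => (k%:R - c) ^+ 2) y =
  (m%:R * y - c) ^+ 2 + m%:R * y * (1 - y).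
Proof.
elim: m c => [|m IH] c /=; first by rewrite !mul0r addr0.
rewrite IH (_ : _ \o S = fun k => (k%:R - (c - 1)) ^+ 2).
  by rewrite IH -natr1; ring.
by apply/funext => k /=; rewrite -natr1; ring.
Qed.

(** Uniform continuity in which only [x] is confined to the segment. The radius is the parameter of
    the near-covering form of compactness, and tends to 0 from the right. *)
Lemma heine F (a b : R) : continuous F -> forall eps : R, 0 < eps ->
  exists2 delta : R, 0 < delta & forall x y, x \in `[a, b] -> `|x - y| < delta ->
    `|F x - F y| < eps.
Proof.
move=> cF eps eps0.
have eps20 : 0 < eps / 2 by rewrite divr_gt0.
have := (@compact_near_coveringP _ _).1 (@segment_compact R a b) R (0^'+)
  (fun delta x => forall y, `|x - y| < delta -> `|F x - F y| < eps) _.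
case.
  move=> x _; have /cvgrPdist_lt/(_ _ eps20)/nbhs_ballP[eta /= eta0 Feta] := cF x.
  have eta20 : 0 < eta / 2 by rewrite divr_gt0.
  exists (ball x (eta / 2), [set d | d < eta / 2]).
    by split; [exact: nbhsx_ballx|exact: nbhs_right_lt].
  move=> [x' d] /= [xx' dl] y x'y.
  have x'x : `|F x - F x'| < eps / 2.
    by apply: Feta; rewrite /ball /= (lt_trans xx') // ltr_pdivrMr // mulr2n mulrDr mulr1 ltrDl.
  have xy : `|F x - F y| < eps / 2.
    apply: Feta; rewrite /ball /= -(subrKA x') (le_lt_trans (ler_normD _ _)) //.
    by rewrite [ltRHS](splitr eta) ltrD // (lt_trans x'y).
  rewrite -(subrKA (F x)) (le_lt_trans (ler_normD _ _)) // [ltRHS](splitr eps).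
  by rewrite ltrD // distrC.
move=> d0 /= d00 Hd0; exists (d0 / 2); first by rewrite divr_gt0.
move=> x y xab; apply: Hd0 => //=; rewrite ?divr_gt0 //.
by rewrite sub0r normrN gtr0_norm ?divr_gt0 // ltr_pdivrMr // mulr2n mulrDr mulr1 ltrDl.
Qed.

(** Bernstein's argument: |F x - F y| is at most eps / 2 plus a multiple of (x - y)^2, and the
    operator, being monotone, carries this over to its variance, which is of order 1 / m after
    rescaling. *)
Lemma bernstein_cvg F : continuous F -> forall eps : R, 0 < eps ->
  exists m, forall y, 0 <= y <= 1 ->
    `|bernstein m (fun k => F (k%:R / m%:R)) y - F y| < eps.
Proof.
move=> cF eps eps0.
have eps20 : 0 < eps / 2 by rewrite divr_gt0.
have [delta delta0 Fdelta] := @heine F 0 1 cF _ eps20.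
have [M M0 FM] : exists2 M : R, 0 < M & forall x, 0 <= x <= 1 -> `|F x| <= M.
  have cF' : {within `[0, 1], continuous (fun x => `|F x|)}.
    apply: continuous_subspaceT => x.
    by apply: (@continuous_comp _ _ _ F Num.norm); [exact: cF|exact: norm_continuous].
  have [c _ cM] := EVT_max ler01 cF'.
  exists (`|F c| + 1); first by rewrite ltr_wpDl.
  by move=> x x01; rewrite (le_trans (cM x _)) ?lerDl // in_itv.
(* With this C, the term C (x - y)^2 dominates the largest possible oscillation 2 M as soon as |x -
   y| >= delta. *)
have [C C0 CM] : exists2 C : R, 0 < C & C * delta ^+ 2 = 2 * M.
  exists (2 * M / delta ^+ 2); first by rewrite divr_gt0 ?mulr_gt0 ?exprn_gt0.
  by rewrite divfK // gt_eqF // exprn_gt0.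
have key x y : 0 <= x <= 1 -> 0 <= y <= 1 ->
    `|F x - F y| <= eps / 2 + C * (x - y) ^+ 2.
  move=> x01 y01; have [xy|xy] := ltP `|x - y| delta.
    rewrite (le_trans (ltW (Fdelta x y _ xy))) ?in_itv //=.
    by rewrite lerDl mulr_ge0 ?sqr_ge0 // ltW.
  rewrite (le_trans (ler_normB _ _)) // (@le_trans _ _ (C * delta ^+ 2)) //.
    by rewrite CM; have := FM x x01; have := FM y y01; lra.
  rewrite (@le_trans _ _ (C * (x - y) ^+ 2)) ?lerDr ?(ltW eps20) //.
  rewrite ler_pM2l // -[(x - y) ^+ 2]real_normK ?num_real //.
  by rewrite lerXn2r ?nnegrE // ltW.
have [m m0 mC] : exists2 m : nat, (0 : R) < m%:R & C / m%:R < eps / 2.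
  exists (Num.truncn (2 * C / eps)).+1; rewrite ?ltr0n //.
  rewrite ltr_pdivrMr ?ltr0n // -ltr_pdivrMl //.
  have -> : (eps / 2)^-1 * C = 2 * C / eps by field; rewrite gt_eqF.
  exact: Num.Theory.truncnS_gt.
exists m => y y01; have /andP[y0 y1] := y01.
pose B := bernstein m (fun k => C / m%:R ^+ 2 * (k%:R - m%:R * y) ^+ 2 + eps / 2) y.
have BE : B < eps.
  apply: (@le_lt_trans _ _ (C / m%:R + eps / 2)); last first.
    by rewrite [ltRHS](splitr eps) ltrD2r.
  rewrite /B !bernstein_affine bernstein_variance subrr.
  rewrite expr0n /= add0r lerD2r.
  have -> : C / m%:R ^+ 2 * (m%:R * y * (1 - y)) = C / m%:R * (y * (1 - y)).
    by field; rewrite gt_eqF.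
  rewrite -[leRHS]mulr1 ler_pM2l ?divr_gt0 //.
  by have := sqr_ge0 (y - 1); nra.
have kE k : (k <= m)%N -> `|F (k%:R / m%:R) - F y| <=
    C / m%:R ^+ 2 * (k%:R - m%:R * y) ^+ 2 + eps / 2.
  move=> km; have k01 : 0 <= (k%:R / m%:R : R) <= 1.
    by rewrite divr_ge0 ?ler0n //= ler_pdivrMr // mul1r ler_nat.
  apply: (le_trans (key _ _ k01 y01)); rewrite addrC lerD2r.
  rewrite le_eqVlt; apply/orP; left; apply/eqP.
  by field; rewrite gt_eqF.
apply: le_lt_trans BE.
set L := bernstein _ _ _.
have LE : L - F y = bernstein m (fun k => 1 * F (k%:R / m%:R) - F y) y.
  by rewrite bernstein_affine mul1r.
have LN : - (L - F y) = bernstein m (fun k => -1 * F (k%:R / m%:R) + F y) y.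
  by rewrite bernstein_affine mulN1r opprB addrC.
rewrite ler_norml lerNl LN LE; apply/andP; split; apply: bernstein_le => // k km.
  by rewrite mulN1r addrC (le_trans _ (kE k km)) // -normrN opprB ler_norm.
by rewrite mul1r (le_trans _ (kE k km)) // ler_norm.
Qed.

Definition cos_poly f := exists (N : nat) (c : nat -> R),
  forall t, f t = \sum_(j < N) c j * cos (j%:R * t).

Lemma cos_poly_widen f (N M : nat) (c : nat -> R) : (N <= M)%N ->
  (forall t, f t = \sum_(j < N) c j * cos (j%:R * t)) ->
  exists c' : nat -> R, forall t, f t = \sum_(j < M) c' j * cos (j%:R * t).
Proof.
move=> NM fE; exists (fun j => if (j < N)%N then c j else 0) => t.
rewrite fE (big_ord_widen M (fun j => c j * cos (j%:R * t))) // big_mkcond.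
by apply: eq_bigr => j _; case: ifP => // _; rewrite mul0r.
Qed.

Lemma cos_poly_lin (a b : R) f F : cos_poly f -> cos_poly F ->
  cos_poly (fun t => a * f t + b * F t).
Proof.
move=> [N [c fE]] [M [d FE]].
have [c' fE'] := cos_poly_widen (leq_maxl N M) fE.
have [d' FE'] := cos_poly_widen (leq_maxr N M) FE.
exists (maxn N M), (fun j => a * c' j + b * d' j) => t.
rewrite fE' FE' !mulr_sumr -big_split; apply: eq_bigr => j _ /=.
by rewrite mulrDl !mulrA.
Qed.

Lemma cos_poly_cos (j : nat) : cos_poly (fun t => cos (j%:R * t)).
Proof.
exists j.+1, (fun i => (i == j)%:R) => t.
rewrite big_ord_recr /= eqxx mul1r big1 ?add0r // => i _.
by rewrite ltn_eqF ?mul0r.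
Qed.

(** By 2 cos t cos (j t) = cos ((j + 1) t) + cos ((j - 1) t). *)
Lemma cos_polyM f : cos_poly f -> cos_poly (fun t => cos t * f t).
Proof.
move=> [N [c fE]].
have -> : (fun t => cos t * f t) =
    (fun t => \sum_(j < N) c j * (cos t * cos (j%:R * t))).
  by apply/funext => t; rewrite fE mulr_sumr; apply: eq_bigr => j _; rewrite mulrCA.
elim: N {f fE} => [|N IH].
  by exists 0%N, c => t; rewrite !big_ord0.
(* The absolute value serves N = 0, where the lower frequency is -1 and evenness of the cosine makes
   it 1. *)
have -> : (fun t => \sum_(j < N.+1) c j * (cos t * cos (j%:R * t))) = (fun t =>
    1 * (\sum_(j < N) c j * (cos t * cos (j%:R * t))) +
    c N * (2^-1 * cos (N.+1%:R * t) + 2^-1 * cos (`|N%:Z - 1|%N%:R * t))).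
  apply/funext => t; rewrite big_ord_recr /= mul1r; congr (_ + _ * _).
  have -> : cos (`|N%:Z - 1|%N%:R * t) = cos (N%:R * t - t).
    case: N {IH} => [|n]; first by rewrite /= mul1r mul0r sub0r cosN.
    have -> : `|n.+1%:Z - 1|%N = n by rewrite -addn1 PoszD addrK absz_nat.
    by rewrite -natr1 mulrDl mul1r addrK.
  by rewrite -[N.+1%:R]natr1 mulrDl mul1r cosD cosB; field.
by apply: cos_poly_lin => //; apply: cos_poly_lin; exact: cos_poly_cos.
Qed.

(** The substitution y = (1 + cos t) / 2 lands in [0, 1], and the recursion only multiplies by
    affine functions of cos t. *)
Lemma cos_poly_bernstein m g :
  cos_poly (fun t => bernstein m g ((1 + cos t) / 2)).
Proof.
elim: m g => [|m IH] g /=.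
  exists 1%N, (fun=> g 0%N) => t.
  by rewrite big_ord1 mul0r cos0 mulr1.
have -> : (fun t => (1 - (1 + cos t) / 2) * bernstein m g ((1 + cos t) / 2) +
     (1 + cos t) / 2 * bernstein m (g \o S) ((1 + cos t) / 2)) =
  (fun t => 1 * (2^-1 * bernstein m g ((1 + cos t) / 2) +
      2^-1 * bernstein m (g \o S) ((1 + cos t) / 2)) +
   1 * (- 2^-1 * (cos t * bernstein m g ((1 + cos t) / 2)) +
    2^-1 * (cos t * bernstein m (g \o S) ((1 + cos t) / 2)))).
  by apply/funext => t; field.
by do ! [apply: cos_poly_lin|apply: cos_polyM] => //; exact: IH.
Qed.

(** [acos] is continuous relative to [-1, 1]; clamping its argument gives a function continuous on
    the whole line, which composes freely. *)
Lemma continuous_acos_clamp :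
  continuous (fun z : R => acos (Num.max (-1) (Num.min 1 z))).
Proof.
have cosin : {in `[0, pi], cancel (@cos R) (@acos R)} by exact: cosK.
have := segment_can_ge_continuous (@pi_ge0 R)
  (continuous_subspaceT (@continuous_cos R)) cosin.
rewrite cospi cos0 => /subspace_continuousP cacos z.
have clampin y : `[-1, 1]%classic (Num.max (-1) (Num.min 1 y) : R).
  by rewrite /= in_itv /= le_max lexx /= ge_max ge_min lexx /= andbT; lra.
apply: (@cvg_comp _ _ _ (fun z : R => Num.max (-1) (Num.min 1 z)) (@acos R) _
  (within `[-1, 1]%classic (nbhs (Num.max (-1) (Num.min 1 z))))); last exact: cacos.
move=> P /= wP.
have cclamp : {for z, continuous (fun y : R => Num.max (-1) (Num.min 1 y))}.
  apply: (@continuous_max _ _ (fun=> -1) (fun y : R => Num.min 1 y)).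
    exact: cvg_cst.
  by apply: (@continuous_min _ _ (fun=> 1) id); [exact: cvg_cst|exact: cvg_id].
have H : \forall y \near z, `[-1, 1]%classic (Num.max (-1) (Num.min 1 y) : R) ->
    P (Num.max (-1) (Num.min 1 y)) by exact: (cclamp _ wP).
by apply: (filterS _ H) => y /=; apply; exact: clampin.
Qed.

(** Weierstrass for even 2 pi-periodic functions: the Bernstein polynomial of y |-> G (acos (2 y -
    1)) is taken at y = (1 + cos t) / 2. Uniformity over all real t allows the later substitution t
    = n x. *)
Lemma cos_poly_dense G : continuous G -> forall eps : R, 0 < eps ->
  exists2 f, cos_poly f & forall t, `|G (acos (cos t)) - f t| < eps.
Proof.
move=> cG eps eps0.
pose F y := G (acos (Num.max (-1) (Num.min 1 (2 * y - 1)))).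
have cGa : continuous (fun z : R => G (acos (Num.max (-1) (Num.min 1 z)))).
  move=> z; apply: (@continuous_comp _ _ _
    (fun z : R => acos (Num.max (-1) (Num.min 1 z))) G); last exact: cG.
  exact: continuous_acos_clamp.
have cF : continuous F.
  move=> y; apply: (@continuous_comp _ _ _ (fun y : R => 2 * y - 1)
    (fun z : R => G (acos (Num.max (-1) (Num.min 1 z))))); last exact: cGa.
  apply: cvgB; last exact: cvg_cst.
  by apply: cvgM; [exact: cvg_cst|exact: cvg_id].
have [m Hm] := bernstein_cvg cF eps0.
exists (fun t => bernstein m (fun k => F (k%:R / m%:R)) ((1 + cos t) / 2)).
  exact: cos_poly_bernstein.
move=> t; have c1 := cos_le1 t; have c2 := cos_geN1 t.
have := Hm ((1 + cos t) / 2); rewrite distrC {1}/F.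
have -> : 2 * ((1 + cos t) / 2) - 1 = cos t by field.
by rewrite min_r // max_r //; apply; apply/andP; split; lra.
Qed.

End weierstrass.
(** * The shape of the eigenfunctions *)

Section fucik_ode.
Context (R : realType).
Implicit Types (a b p q x y A B C c r : R) (u du v dv : R -> R).

(** The equation as a first-order system in (u, u') on the open interval; initial data are supplied
    separately by [starts_at]. *)
Definition fucik_solves a b p q u du := forall x, p < x < q ->
  is_derive x 1 u (du x) /\
  is_derive x 1 du (b * Num.max (- u x) 0 - a * Num.max (u x) 0).

(* (A, D) are the right limits of (u, du) at p, in the weak sense of a cluster
   point: at 0 the Neumann condition and the mean value theorem give no more. *)
Definition starts_at p u du (A D : R) := forall eps x, 0 < eps -> p < x ->
  exists y, [/\ p < y, y < x, `|u y - A| < eps & `|du y - D| < eps].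

Lemma continuous_starts_at p u du : {for p, continuous u} ->
  {for p, continuous du} -> starts_at p u du (u p) (du p).
Proof.
move=> cu cdu eps x eps0 px.
have /cvgrPdist_lt/(_ _ eps0) Hu := cu.
have /cvgrPdist_lt/(_ _ eps0) Hdu := cdu.
near p^'+ => y; exists y; split.
- by near: y; exact: nbhs_right_gt.
- by near: y; exact: nbhs_right_lt.
- by rewrite distrC; near: y; apply: cvg_within; exact: Hu.
- by rewrite distrC; near: y; apply: cvg_within; exact: Hdu.
Unshelve. all: by end_near. Qed.

Lemma fucik_rhs_lipschitz a b s t : 0 <= a -> 0 <= b ->
  `|(b * Num.max (- s) 0 - a * Num.max s 0) -
    (b * Num.max (- t) 0 - a * Num.max t 0)| <= (a + b) * `|s - t|.
Proof.
move=> a0 b0.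
have -> : b * Num.max (- s) 0 - a * Num.max s 0 -
    (b * Num.max (- t) 0 - a * Num.max t 0) =
  b * (Num.max (- s) 0 - Num.max (- t) 0) - a * (Num.max s 0 - Num.max t 0).
  by ring.
rewrite (le_trans (ler_normB _ _)) // !normrM (ger0_norm a0) (ger0_norm b0).
rewrite mulrDl addrC.
rewrite lerD // ler_wpM2l ?max_lipschitz //.
by rewrite (le_trans (max_lipschitz _ _ _)) // opprK addrC distrC.
Qed.

(** Gronwall's argument: the squared distance E of the two phase curves satisfies E' <= k E, so E
    exp (- k x) is nonincreasing. Points arbitrarily near [p] at which E is small therefore suffice,
    which is why a cluster point is enough as initial condition. *)
Lemma fucik_ode_unique a b p q u du v dv : 0 <= a -> 0 <= b ->
  fucik_solves a b p q u du -> fucik_solves a b p q v dv ->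
  {for p, continuous v} -> {for p, continuous dv} ->
  starts_at p u du (v p) (dv p) ->
  forall x, p < x < q -> u x = v x /\ du x = dv x.
Proof.
move=> a0 b0 su sv cv cdv st.
pose E x := (u x - v x) ^+ 2 + (du x - dv x) ^+ 2.
(* With s = u - v and t = u' - v', the term 2 s t of E' costs 1, and the Lipschitz constant a + b of
   the right-hand side costs the rest. *)
pose k : R := 1 + (a + b).
have k0 : 0 < k by rewrite /k; lra.
pose G x := E x * expR (- k * x).
have dG x : p < x < q -> exists2 d, is_derive x 1 G d & d <= 0.
  move=> xpq; have [u1 u2] := su x xpq; have [v1 v2] := sv x xpq.
  have := fucik_rhs_lipschitz (u x) (v x) a0 b0.
  set f := b * _ - _ in u2 *; set g := b * _ - _ in v2 *; move=> fg.
  exists ((2 * (u x - v x) * (du x - dv x) + 2 * (du x - dv x) * (f - g)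
    - k * E x) * expR (- k * x)).
    apply: is_derive_eq; rewrite /GRing.scale /= /E; ring.
  rewrite pmulr_lle0 ?expR_gt0 // subr_le0 /E /k.
  move: (u x - v x) (du x - dv x) (f - g) fg => s t w ws.
  have : `|2 * t * w| <= (a + b) * (s ^+ 2 + t ^+ 2).
    rewrite normrM normrM ger0_norm //.
    rewrite (@le_trans _ _ (2 * `|t| * ((a + b) * `|s|))) ?ler_wpM2l ?mulr_ge0 //.
    rewrite -[s ^+ 2]real_normK ?num_real // -[t ^+ 2]real_normK ?num_real //.
    by have := sqr_ge0 (`|s| - `|t|); nra.
  move=> /(le_trans (ler_norm _)); have := sqr_ge0 (s - t); nra.
have G_decr x y : p < x -> x <= y -> y < q -> G y <= G x.
  move=> px xy yq.
  have D z : z \in `]p, q[ -> derivable G z 1.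
    by rewrite in_itv => /dG[d dz _]; exact: (@ex_derive _ _ _ _ _ _ _ dz).
  apply: (@ler0_derive1_le_oo _ G p q) => //; rewrite ?in_itv /=.
  - move=> z; rewrite in_itv => /dG[d dz d0].
    by rewrite derive1E (@derive_val _ _ _ _ _ _ _ dz).
  - by move=> z /set_mem /= zpq; apply/differentiable_continuous/derivable1_diffP/D.
  - by apply/andP; split; lra.
  - by apply/andP; split; lra.
move=> x /andP[px xq].
have E0 : E x <= 0.
  apply/ler_addgt0Pr => eps eps0; rewrite add0r.
  pose M := expR (k * (x - p)); have M0 : 0 < M by exact: expR_gt0.
  (* Near the cluster point E is at most 8 d^2, weakened to 8 d by d <= 1; M bounds the exponential
     growth from [p] to [x]. *)
  have [d [d0 d1 dM]] : exists d : R, [/\ 0 < d, d <= 1 & 8 * d * M <= eps].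
    exists (Num.min 1 (eps / (8 * M))); rewrite lt_min ltr01 divr_gt0 ?mulr_gt0 //.
    split=> //; first by rewrite ge_min lexx.
    rewrite mulrAC -ler_pdivlMl ?mulr_gt0 // mulrC.
    by rewrite ge_min lexx orbT.
  have /cvgrPdist_lt/(_ _ d0)/nbhs_ballP[e1 /= e10 He1] := cv.
  have /cvgrPdist_lt/(_ _ d0)/nbhs_ballP[e2 /= e20 He2] := cdv.
  have px' : p < Num.min x (p + Num.min e1 e2).
    by rewrite lt_min px ltrDl lt_min e10.
  have [y [py yx' uy duy]] := st _ _ d0 px'.
  move: yx'; rewrite lt_min => /andP[yx].
  rewrite -ltrBlDl lt_min => /andP[ye1 ye2].
  have vy : `|v p - v y| < d.
    by apply: He1; rewrite /ball /= distrC gtr0_norm // subr_gt0.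
  have dvy : `|dv p - dv y| < d.
    by apply: He2; rewrite /ball /= distrC gtr0_norm // subr_gt0.
  have Ey : E y <= 8 * d.
    have s1 : `|u y - v y| <= 2 * d.
      rewrite -(subrKA (v p)) (le_trans (ler_normD _ _)) //; lra.
    have s2 : `|du y - dv y| <= 2 * d.
      rewrite -(subrKA (dv p)) (le_trans (ler_normD _ _)) //; lra.
    rewrite /E -[(u y - v y) ^+ 2]real_normK ?num_real //.
    rewrite -[(du y - dv y) ^+ 2]real_normK ?num_real //.
    move: s1 s2 (normr_ge0 (u y - v y)) (normr_ge0 (du y - dv y)).
    move: `|u y - v y| `|du y - dv y| => s t; nra.
  have Gyx := G_decr y x py (ltW yx) xq.
  apply: le_trans dM; rewrite -(ler_pM2r (expR_gt0 (- k * x))).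
  apply: (le_trans Gyx); rewrite /G /M -[leRHS]mulrA -expRD.
  have -> : k * (x - p) + - k * x = - k * p by ring.
  apply: ler_pM => //; rewrite ?expR_ge0 // /E ?addr_ge0 ?sqr_ge0 //.
  by rewrite ler_expR; nra.
have := E0; rewrite /E; have := sqr_ge0 (u x - v x); have := sqr_ge0 (du x - dv x).
move=> h1 h2 h3.
have /eqP : (u x - v x) ^+ 2 = 0 by lra.
have /eqP : (du x - dv x) ^+ 2 = 0 by lra.
by rewrite !sqrf_eq0 !subr_eq0 => /eqP -> /eqP ->.
Qed.

Lemma is_derive_cos_affine C r c x :
  is_derive x 1 (fun x => C * cos (r * (x - c))) (- C * r * sin (r * (x - c))).
Proof.
by apply: is_derive_eq; rewrite /GRing.scale /=; ring.
Qed.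

Lemma is_derive_sin_affine C r c x :
  is_derive x 1 (fun x => C * sin (r * (x - c))) (C * r * cos (r * (x - c))).
Proof.
by apply: is_derive_eq; rewrite /GRing.scale /=; ring.
Qed.

Lemma cos_fucik_solves_pos p q b C r c : 0 <= C ->
  (forall x, p < x < q -> 0 <= cos (r * (x - c))) ->
  fucik_solves (r ^+ 2) b p q (fun x => C * cos (r * (x - c)))
    (fun x => - C * r * sin (r * (x - c))).
Proof.
move=> C0 cos0 x xpq; split; first exact: is_derive_cos_affine.
have := is_derive_sin_affine (- C * r) r c x.
have Cc : 0 <= C * cos (r * (x - c)) by rewrite mulr_ge0 // cos0.
rewrite max_r ?oppr_le0 // max_l // => /is_derive_eq; apply; ring.
Qed.

Lemma cos_fucik_solves_neg p q a C r c : C <= 0 ->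
  (forall x, p < x < q -> 0 <= cos (r * (x - c))) ->
  fucik_solves a (r ^+ 2) p q (fun x => C * cos (r * (x - c)))
    (fun x => - C * r * sin (r * (x - c))).
Proof.
move=> C0 cos0 x xpq; split; first exact: is_derive_cos_affine.
have := is_derive_sin_affine (- C * r) r c x.
have Cc : C * cos (r * (x - c)) <= 0 by rewrite mulr_le0_ge0 // cos0.
rewrite max_l ?oppr_ge0 // max_r // => /is_derive_eq; apply; ring.
Qed.

End fucik_ode.

(** * Descent from a maximum to the next minimum *)

Section fucik_profile.
Context (R : realType).
Implicit Types (a b p q x y s t A B C c ra rb : R) (f g u du v dv : R -> R).

Lemma continuous_eq_left f g p q : p < q ->
  f x @[x --> q^'-] --> f q -> g x @[x --> q^'-] --> g q ->
  (forall x, p < x < q -> f x = g x) -> f q = g q.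
Proof.
move=> pq fq gq fg; apply: (@cvg_unique _ (@Rhausdorff R) (f x @[x --> q^'-])) => //.
apply: cvg_trans gq; apply: near_eq_cvg; near=> x; apply/esym/fg/andP; split.
  by near: x; exact: nbhs_left_gt.
by near: x; exact: nbhs_left_lt.
Unshelve. all: by end_near. Qed.

Lemma fucik_solvesS a b p q p' q' u du : p <= p' -> q' <= q ->
  fucik_solves a b p q u du -> fucik_solves a b p' q' u du.
Proof.
move=> pp' qq' su x /andP[p'x xq']; apply: su.
by rewrite (le_lt_trans pp') // (lt_le_trans xq').
Qed.

Lemma fucik_solvesN a b p q u du : fucik_solves a b p q u du ->
  fucik_solves b a p q (fun x => - u x) (fun x => - du x).
Proof.
move=> su x /su[d1 d2]; split; first exact: is_deriveN.
by apply: is_derive_eq; rewrite opprK opprB.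
Qed.

Lemma starts_atN p u du A B : starts_at p u du A B ->
  starts_at p (fun x => - u x) (fun x => - du x) (- A) (- B).
Proof.
move=> st eps x eps0 px; have [y [py yx uy duy]] := st eps x eps0 px.
by exists y; split=> //; rewrite -opprD normrN.
Qed.

Lemma fucik_solves_continuous a b p q u du : fucik_solves a b p q u du ->
  forall x, p < x < q -> {for x, continuous u} /\ {for x, continuous du}.
Proof.
move=> su x /su[d1 d2]; split; apply/differentiable_continuous/derivable1_diffP;
  [exact: (@ex_derive _ _ _ _ _ _ _ d1)|exact: (@ex_derive _ _ _ _ _ _ _ d2)].
Qed.

(** From height A with zero slope, u follows a cosine of frequency ra down to its zero z, then one
    of frequency rb down to - A ra / rb, the depth for which the slopes match at z. Capping both
    arguments at pi / 2 kills the inactive cosine, so one formula serves both phases. The last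
    clause yields the zero slope at q with which the next piece starts. *)
Lemma fucik_hump A ra rb p u du : 0 < A -> 0 < ra -> 0 < rb ->
  let q := p + pi / 2 / ra + pi / 2 / rb in
  fucik_solves (ra ^+ 2) (rb ^+ 2) p q u du -> starts_at p u du A 0 ->
  (forall x, p < x < q -> u x = A * cos (Num.min (ra * (x - p)) (pi / 2)) -
     A * ra / rb * cos (Num.min (rb * (q - x)) (pi / 2))) /\
  (exists2 z, p < z < q & forall x, z < x < q ->
     du x = - (A * ra) * sin (rb * (q - x))).
Proof.
move=> A0 ra0 rb0 q su st; pose z := p + pi / 2 / ra.
have pi20 : 0 < (pi / 2 : R) by rewrite divr_gt0 ?pi_gt0.
have pz : p < z by rewrite ltrDl divr_gt0.
have zq : z < q by rewrite ltrDl divr_gt0.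
have raz : ra * (z - p) = pi / 2 by rewrite /z addrC addKr mulrC divfK ?gt_eqF.
have rbz : rb * (q - z) = pi / 2 by rewrite /q addrC addKr mulrC divfK ?gt_eqF.
have ra20 : 0 <= ra ^+ 2 by rewrite sqr_ge0.
have rb20 : 0 <= rb ^+ 2 by rewrite sqr_ge0.
have cont C r c x : {for x, continuous (fun x => C * cos (r * (x - c)))} /\
    {for x, continuous (fun x => - C * r * sin (r * (x - c)))}.
  split; apply/differentiable_continuous/derivable1_diffP.
    exact: (@ex_derive _ _ _ _ _ _ _ (is_derive_cos_affine C r c x)).
  exact: (@ex_derive _ _ _ _ _ _ _ (is_derive_sin_affine (- C * r) r c x)).
have cos1 x : p < x < z -> 0 <= cos (ra * (x - p)).
  move=> /andP[px xz]; apply: cos_ge0_pihalf; rewrite -raz.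
  by rewrite ler_pM2l // lerD2r (ltW xz) andbT; nra.
have cos2 x : z < x < q -> 0 <= cos (rb * (x - q)).
  move=> /andP[zx xq]; rewrite -cosN; apply: cos_ge0_pihalf; rewrite -rbz.
  by apply/andP; split; nra.
have u1 x : p < x < z -> u x = A * cos (ra * (x - p)) /\
    du x = - A * ra * sin (ra * (x - p)).
  have [cv cdv] := cont A ra p p.
  apply: (fucik_ode_unique ra20 rb20 _ _ cv cdv).
  - exact: fucik_solvesS (ltW zq) su.
  - exact: cos_fucik_solves_pos (ltW A0) cos1.
  - by rewrite subrr mulr0 cos0 sin0 mulr1 mulr0.
have [cuz cduz] := fucik_solves_continuous su (introT andP (conj pz zq)).
have uz : u z = 0.
  rewrite (@continuous_eq_left u (fun x => A * cos (ra * (x - p))) p z) //.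
  - by rewrite raz cos_pihalf mulr0.
  - exact: cvg_at_left_filter cuz.
  - by apply: cvg_at_left_filter; exact: (cont A ra p z).1.
  - by move=> x /u1[].
have duz : du z = - A * ra.
  rewrite (@continuous_eq_left du (fun x => - A * ra * sin (ra * (x - p))) p z) //.
  - by rewrite raz sin_pihalf mulr1.
  - exact: cvg_at_left_filter cduz.
  - by apply: cvg_at_left_filter; exact: (cont A ra p z).2.
  - by move=> x /u1[].
pose B := A * ra / rb; have B0 : 0 < B by rewrite divr_gt0 ?mulr_gt0.
have u2 x : z < x < q -> u x = - B * cos (rb * (x - q)) /\
    du x = - - B * rb * sin (rb * (x - q)).
  have [cv cdv] := cont (- B) rb q z.
  apply: (fucik_ode_unique ra20 rb20 _ _ cv cdv).
  - exact: fucik_solvesS (ltW pz) (lexx _) su.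
  - by apply: cos_fucik_solves_neg cos2; rewrite oppr_le0 ltW.
  - have -> : rb * (z - q) = - (pi / 2) by rewrite -rbz; ring.
    rewrite cosN sinN cos_pihalf sin_pihalf mulr0.
    rewrite (_ : _ * -1 = - A * ra); last by rewrite /B; field; rewrite gt_eqF.
    by rewrite -uz -duz; exact: continuous_starts_at.
split=> [x /andP[px xq]|].
  case: (ltgtP x z) => [xz|zx|->].
  - rewrite (u1 x _).1 ?px // min_l; last by rewrite -raz ler_pM2l // lerD2r ltW.
    rewrite min_r; last by rewrite -rbz ler_pM2l // lerD2l lerN2 ltW.
    by rewrite cos_pihalf mulr0 subr0.
  - rewrite (u2 x _).1 ?zx // min_r; last by rewrite -raz ler_pM2l // lerD2r ltW.
    rewrite min_l; last by rewrite -rbz ler_pM2l // lerD2l lerN2 ltW.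
    have -> : rb * (x - q) = - (rb * (q - x)) by ring.
    by rewrite cosN cos_pihalf mulr0 add0r mulNr.
  - by rewrite raz rbz minxx cos_pihalf !mulr0 subr0 uz.
exists z; first by rewrite pz.
move=> x /u2[_ ->]; have -> : rb * (x - q) = - (rb * (q - x)) by ring.
by rewrite sinN /B; field; rewrite gt_eqF.
Qed.

(** The decreasing function on [0, pi] behind f^n, for positive parameters. When 1 / ra + 1 / rb =
    2, the two cosines are never both nonzero there. *)
Definition fucik_profile A B ra rb s : R :=
  A * cos (Num.min (ra * s) (pi / 2)) - B * cos (Num.min (rb * (pi - s)) (pi / 2)).

Lemma continuous_fucik_profile A B ra rb : continuous (fucik_profile A B ra rb).
Proof.
have cmin f : continuous f -> continuous (fun x => cos (Num.min (f x) (pi / 2))).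
  move=> cf x; apply: (@continuous_comp _ _ _ (fun x => Num.min (f x) (pi / 2)) cos).
    by apply: (@continuous_min _ _ f (fun=> pi / 2)); [exact: cf|exact: cvg_cst].
  exact: continuous_cos.
move=> s; apply: cvgB; apply: cvgM; try exact: cvg_cst.
  apply: (cmin (fun x => ra * x)) => x.
  by apply: cvgM; [exact: cvg_cst|exact: cvg_id].
apply: (cmin (fun x => rb * (pi - x))) => x; apply: cvgM; first exact: cvg_cst.
by apply: cvgB; [exact: cvg_cst|exact: cvg_id].
Qed.

Lemma continuous_acos_cos f : continuous f -> continuous (fun t => f (acos (cos t))).
Proof.
move=> cf.
have -> : (fun t => f (acos (cos t))) =
    (fun t => f (acos (Num.max (-1) (Num.min 1 (cos t))))).
  apply/funext => t; rewrite min_r ?cos_le1 // max_r ?cos_geN1 //.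
have c1 : continuous (fun t : R => acos (Num.max (-1) (Num.min 1 (cos t)))).
  move=> t; apply: (@continuous_comp _ _ _ cos
    (fun z : R => acos (Num.max (-1) (Num.min 1 z)))); first exact: continuous_cos.
  exact: continuous_acos_clamp.
move=> t; apply: (@continuous_comp _ _ _
  (fun t : R => acos (Num.max (-1) (Num.min 1 (cos t)))) f); first exact: c1.
exact: cf.
Qed.

(** The triangle wave of period 2 pi: a shift by m pi multiplies the cosine by (-1)^m, and
    reflection absorbs the sign when m is odd. *)
Lemma acos_cos_pieces (m : nat) t : m%:R * pi <= t <= m.+1%:R * pi ->
  acos (cos t) = if odd m then m.+1%:R * pi - t else t - m%:R * pi.
Proof.
have cosD k x : cos (x + k%:R * pi) = (-1) ^+ k * cos x :> R.
  by rewrite -(alternatingn (@cosDpi R)) mulr_natl.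
move=> /andP[mt tm]; have mS : m.+1%:R * pi = m%:R * pi + pi :> R.
  by rewrite -natr1 mulrDl mul1r.
case: ifPn => om.
  have -> : cos t = cos (m.+1%:R * pi - t).
    by rewrite addrC cosD cosN exprS -signr_odd om expr1 mulrNN mulr1 mul1r.
  by rewrite cosK // in_itv /=; apply/andP; split; lra.
have -> : cos t = cos (t - m%:R * pi).
  by rewrite -[in LHS](subrK (m%:R * pi) t) cosD -signr_odd (negbTE om) mul1r.
by rewrite cosK // in_itv /=; apply/andP; split; lra.
Qed.

End fucik_profile.

(** * Assembling an eigenfunction from its monotone pieces *)

Section fucik_eigenfunction_shape.
Context (R : realType).
Implicit Types (a b p q x y s t A B C c ra rb : R) (f g u du v dv : R -> R).

Lemma right_diff_quotient_bound f (l : R) : h^-1 * (f h - l) @[h --> 0^'+] --> (0 : R) ->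
  forall eps, 0 < eps -> exists2 d, 0 < d & forall h, 0 < h < d -> `|f h - l| < eps * h.
Proof.
move=> /cvgrPdist_lt fl eps eps0; have [d /= d0 Hd] := fl _ eps0.
exists d => // h /andP[h0 hd]; have := Hd h; rewrite /= sub0r normrN (gtr0_norm h0).
move=> /(_ hd h0); rewrite sub0r normrN normrM normfV (gtr0_norm h0).
by rewrite ltr_pdivrMl // mulrC.
Qed.

Lemma left_diff_quotient_bound f (l : R) : h^-1 * (f h - l) @[h --> 0^'-] --> (0 : R) ->
  forall eps, 0 < eps -> exists2 d, 0 < d &
    forall h, - d < h < 0 -> `|f h - l| < eps * - h.
Proof.
move=> /cvgrPdist_lt fl eps eps0; have [d /= d0 Hd] := fl _ eps0.
exists d => // h /andP[hd h0]; have := Hd h; rewrite /= sub0r normrN (ltr0_norm h0).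
rewrite ltrNl => /(_ hd h0); rewrite sub0r normrN normrM normfV (ltr0_norm h0).
by rewrite ltr_pdivrMl ?oppr_gt0 // mulrC.
Qed.

Lemma fucik_solution_solves a b u : fucik_solution a b u ->
  fucik_solves a b 0 pi u (derive1 u).
Proof.
move=> [su _ _] x x0pi; have xin : x \in `]0, pi[ by rewrite in_itv.
have [du ddu _ eq] := su x xin.
split; first by rewrite derive1E; exact: derivableP.
have -> : b * Num.max (- u x) 0 - a * Num.max (u x) 0 = derive1 (derive1 u) x.
  by rewrite -[RHS]opprK eq /funrpos /funrneg opprB.
by rewrite derive1E; exact: derivableP.
Qed.

(** The Neumann condition makes the difference quotient of u on [0, y] small, and the mean value
    theorem realises that quotient as u' at some point between 0 and y. *)
Lemma fucik_solution_starts a b u : fucik_solution a b u ->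
  starts_at 0 u (derive1 u) (u 0) 0.
Proof.
move=> sol eps x eps0 x0; have su := fucik_solution_solves sol.
have [_ /right_diff_quotient_bound u0 _] := sol.
have e0 : 0 < Num.min eps 1 by rewrite lt_min eps0 ltr01.
have [d d0 ud] := u0 _ e0.
have [y [y0 yd yx y1 ypi]] : exists y, [/\ 0 < y, y < d, y < x, y < 1 & y < pi].
  pose m := Num.min (Num.min d x) (Num.min 1 pi).
  have m0 : 0 < m by rewrite !lt_min d0 x0 ltr01 pi_gt0.
  have m2 : m / 2 < m by lra.
  have := m2; rewrite [in ltRHS]/m !lt_min => /andP[/andP[? ?] /andP[? ?]].
  by exists (m / 2); rewrite divr_gt0.
have inside z : 0 < z -> z <= y -> 0 < z < pi.
  by move=> z0 zy; rewrite z0 (le_lt_trans zy).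
have [||xi] := @MVT _ u (derive1 u) 0 y y0.
- by move=> z; rewrite in_itv /= => /andP[z0 zy]; exact: (su z (inside z z0 (ltW zy))).1.
- apply/continuous_within_itvP => //; split.
  + move=> z; rewrite in_itv /= => /andP[z0 zy].
    exact: (fucik_solves_continuous su (inside z z0 (ltW zy))).1.
  + apply/cvgrPdist_lt => e e1; have [d' d'0 ud'] := u0 _ e1.
    near=> h; rewrite distrC.
    have h0 : 0 < h by near: h; exact: nbhs_right_gt.
    have hd' : h < d' by near: h; exact: nbhs_right_lt.
    have h1 : h < 1 by near: h; exact: nbhs_right_lt.
    by rewrite (lt_trans (ud' h _)) ?h0 // gtr_pMr.
  + apply: cvg_at_left_filter.
    exact: (fucik_solves_continuous su (inside y y0 (lexx _))).1.
rewrite in_itv /= subr0 => /andP[xi0 xiy] uxi.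
exists xi; split=> //; first exact: lt_trans xiy yx.
- apply: lt_trans (ud xi _) _; first by rewrite xi0 (lt_trans xiy).
  rewrite (@le_lt_trans _ _ (eps * xi)) ?ler_pM2r ?ge_min ?lexx //.
  by rewrite gtr_pMr // (lt_trans xiy).
- have := ud y; rewrite y0 yd uxi normrM (gtr0_norm y0) => /(_ isT).
  rewrite ltr_pM2r // subr0 => /lt_le_trans; apply.
  by rewrite ge_min lexx.
Unshelve. all: by end_near. Qed.

Lemma fucik_solution_left_pi a b u : fucik_solution a b u ->
  u x @[x --> pi^'-] --> u pi.
Proof.
move=> [_ _ /(@left_diff_quotient_bound (fun h => u (pi + h))) upi].
have [d d0 ud] := upi 1 ltr01.
apply/cvgrPdist_lt => e e0; near=> x.
have xpi : x < pi by near: x; exact: nbhs_left_lt.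
have xd : pi - d < x by near: x; apply: nbhs_left_gt; rewrite gtrBl.
have xe : pi - e < x by near: x; apply: nbhs_left_gt; rewrite gtrBl.
have := ud (x - pi); rewrite (addrC pi) subrK distrC mul1r => xlt.
apply: lt_trans (xlt _) _; last by rewrite opprB; lra.
by apply/andP; split; lra.
Unshelve. all: by end_near. Qed.

(** The nodes P m = m pi / n cut [0, pi] into pieces on which u descends and ascends alternately. An
    ascent is a descent of - u with the two frequencies exchanged and starting height B; it ends at
    height A because B rb / ra = A. Left limits pass the value and the zero slope on to the next
    piece. *)
Lemma fucik_solution_profile (n : nat) a b ra rb u : (0 < n)%N ->
  a = ra ^+ 2 -> b = rb ^+ 2 -> 0 < ra -> 0 < rb ->
  pi / 2 / ra + pi / 2 / rb = pi / n%:R -> fucik_solution a b u -> 0 < u 0 ->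
  forall x, 0 <= x <= pi ->
    u x = fucik_profile (u 0) (u 0 * ra / rb) (ra / n%:R) (rb / n%:R)
      (acos (cos (n%:R * x))).
Proof.
move=> n0 aE bE ra0 rb0 rab sol u00.
have su := fucik_solution_solves sol; have st0 := fucik_solution_starts sol.
have uleft := fucik_solution_left_pi sol.
set A := u 0 in u00 st0 *; set B := A * ra / rb; set N : R := n%:R in rab *.
have B0 : 0 < B by rewrite divr_gt0 ?mulr_gt0.
have N0 : 0 < N by rewrite ltr0n.
set du := derive1 u in su st0.
pose g x := fucik_profile A B (ra / N) (rb / N) (acos (cos (N * x))).
have cg : continuous g.
  move=> x; apply: (@continuous_comp _ _ _ (fun x => N * x)
    (fun t => fucik_profile A B (ra / N) (rb / N) (acos (cos t)))).
    by apply: cvgM; [exact: cvg_cst|exact: cvg_id].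
  by apply: continuous_acos_cos; exact: continuous_fucik_profile.
pose P m : R := m%:R * (pi / N).
have PS m : P m.+1 = P m + pi / N by rewrite /P -natr1 mulrDl mul1r.
have PPS m : P m < P m.+1 by rewrite PS ltrDl divr_gt0 ?pi_gt0.
have NP m : N * P m = m%:R * pi by rewrite /P mulrCA [N * _]mulrC divfK ?gt_eqF.
have P_pi m : (m <= n)%N -> P m <= pi.
  by move=> mn; rewrite -(ler_pM2l N0) NP ler_wpM2r ?pi_ge0 // ler_nat.
have P_ge0 m : 0 <= P m by rewrite mulr_ge0 // divr_ge0 ?pi_ge0 // ltW.
have acosP m x : P m < x < P m.+1 -> acos (cos (N * x)) =
    if odd m then N * (P m.+1 - x) else N * (x - P m).
  move=> /andP[mx xm]; rewrite (@acos_cos_pieces _ m) -?NP; last first.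
    by rewrite !ler_pM2l // (ltW mx) (ltW xm).
  by rewrite !mulrBr.
have piece m : (m < n)%N -> starts_at (P m) u du (if odd m then - B else A) 0 ->
    (forall x, P m < x < P m.+1 -> u x = g x) /\
    exists2 z, P m < z < P m.+1 & exists k r, forall x, z < x < P m.+1 ->
      du x = k * sin (r * (P m.+1 - x)).
  move=> mn; have sum := fucik_solvesS (P_ge0 m) (P_pi _ mn) su.
  have E c s : c / N * (N * s) = c * s by rewrite mulrA divfK // gt_eqF.
  have F m' x : pi - N * (x - P m') = N * (P m'.+1 - x).
    by rewrite PS; field; rewrite gt_eqF.
  have F' m' x : pi - N * (P m'.+1 - x) = N * (x - P m').
    by rewrite PS; field; rewrite gt_eqF.
  case: ifPn => om st.
    have := @fucik_hump _ B rb ra (P m) (fun x => - u x) (fun x => - du x) B0 rb0 ra0.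
    rewrite /= -addrA [pi / 2 / rb + _]addrC rab -PS.
    rewrite aE bE in sum; case.
    - exact: fucik_solvesN.
    - by rewrite -[B]opprK -[0]oppr0; exact: starts_atN.
    move=> um [z zm dum]; split=> [x xm|].
      rewrite /g (acosP m) // om -[LHS]opprK um // /fucik_profile.
      rewrite F' !E opprB; congr (_ * _ - _).
      by rewrite /B; field; rewrite !gt_eqF.
    exists z => //; exists (B * rb), ra => x /dum dux.
    by rewrite -[LHS]opprK dux mulNr opprK.
  have := @fucik_hump _ A ra rb (P m) u du u00 ra0 rb0.
  rewrite /= -addrA rab -PS.
  rewrite aE bE in sum; case=> // um [z zm dum]; split=> [x xm|].
    by rewrite /g (acosP m) // (negbTE om) um // /fucik_profile F !E.
  by exists z => //; exists (- (A * ra)), rb.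
have gP m : g (P m) = if odd m then - B else A.
  have pi2 : 0 < (pi / 2 : R) by rewrite divr_gt0 ?pi_gt0.
  have raN : ra / N * pi = pi / 2 + pi / 2 * ra / rb.
    rewrite mulrAC -[ra * pi / N]mulrA -rab; field; rewrite !gt_eqF //.
  have rbN : rb / N * pi = pi / 2 + pi / 2 * rb / ra.
    rewrite mulrAC -[rb * pi / N]mulrA -rab; field; rewrite !gt_eqF //.
  rewrite /g NP (@acos_cos_pieces _ m) ?lexx ?ler_wpM2r ?pi_ge0 ?ler_nat //.
  rewrite subrr -mulrBl -natrB // subSnn mul1r /fucik_profile.
  case: ifP => _.
    rewrite subrr mulr0 [Num.min 0 _]min_l ?(ltW pi2) // cos0 min_r.
      by rewrite cos_pihalf mulr0 sub0r mulr1.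
    by rewrite raN lerDl ltW // divr_gt0 // mulr_gt0.
  rewrite subr0 mulr0 [Num.min 0 _]min_l ?(ltW pi2) // cos0 min_r.
    by rewrite cos_pihalf mulr0 subr0 mulr1.
  by rewrite rbN lerDl ltW // divr_gt0 // mulr_gt0.
have Pn : P n = pi by rewrite /P -/N mulrC divfK ?gt_eqF.
have Pin m : (m.+1 < n)%N -> 0 < P m.+1 < pi.
  move=> mn; rewrite (le_lt_trans (P_ge0 m)) //=.
  by rewrite (lt_le_trans (PPS m.+1)) // P_pi.
have starts m : (m < n)%N -> starts_at (P m) u du (if odd m then - B else A) 0.
  elim: m => [|m IH] mn; first by rewrite /P mul0r.
  have [ug [z zm [k [r dum]]]] := piece m (ltnW mn) (IH (ltnW mn)).
  have [cu cdu] := fucik_solves_continuous su (Pin m mn).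
  have uP : u (P m.+1) = if odd m.+1 then - B else A.
    rewrite -gP; apply: (continuous_eq_left (PPS m)) => //.
      exact: cvg_at_left_filter cu.
    by apply: cvg_at_left_filter; exact: cg.
  have duP : du (P m.+1) = 0.
    have /andP[_ zP] := zm.
    rewrite (@continuous_eq_left _ du (fun x => k * sin (r * (P m.+1 - x))) z (P m.+1)) //.
    - by rewrite subrr mulr0 sin0 mulr0.
    - exact: cvg_at_left_filter cdu.
    - apply: cvg_at_left_filter; apply: cvgM; first exact: cvg_cst.
      apply: (@continuous_comp _ _ _ (fun x => r * (P m.+1 - x)) sin).
        apply: cvgM; first exact: cvg_cst.
        by apply: cvgB; [exact: cvg_cst|exact: cvg_id].
      exact: continuous_sin.
  by rewrite -uP -duP; exact: continuous_starts_at.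
have onP m : (m <= n)%N -> u (P m) = g (P m).
  case: m => [_|m mn]; first by rewrite gP /P mul0r.
  apply: (continuous_eq_left (PPS m)) => //.
  (* At the last node, which is pi, only the left limit of u is known; the other nodes are
     interior. *)
  - have [mn'|] := ltnP m.+1 n; last first.
      by move=> nm; rewrite (_ : m.+1 = n) ?Pn //; apply/eqP; rewrite eqn_leq mn.
    by apply: cvg_at_left_filter; exact: (fucik_solves_continuous su (Pin m mn')).1.
  - by apply: cvg_at_left_filter; exact: cg.
  - exact: (piece m mn (starts m mn)).1.
move=> x /andP[x0 xpi]; rewrite -/(g x).
have Hn k : (k <= n)%N -> x <= P k -> u x = g x.
  elim: k => [_ xP|k IH kn xP].
    have -> : x = P 0%N by apply/eqP; rewrite eq_le xP /P mul0r x0.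
    exact: onP.
  have [xk|kx] := leP x (P k); first exact: IH (ltnW kn) xk.
  move: xP; rewrite le_eqVlt => /orP[/eqP ->|xk]; first exact: onP.
  by apply: (piece k kn (starts k kn)).1; rewrite kx.
by apply: (Hn n) => //; rewrite Pn.
Qed.

End fucik_eigenfunction_shape.
(** * The Hilbert space L^2 and its cosine basis *)

Section L2_classes.
Context d (T : measurableType d) (R : realType).
Variable mu : {measure set T -> \bar R}.
Local Notation L := (LspaceType mu (lee1n 2)).
Implicit Types (f g h : T -> R) (F G : L).

Lemma L2norm_sqr F f : measurable_fun setT f -> (F : T -> R) = f %[ae mu] ->
  (`|F| ^+ 2)%:E = (\int[mu]_x (f x ^+ 2)%:E)%E.
Proof.
move=> mf Ff; rewrite L2norm_dot /L2dot /Rintegral fineK; last first.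
  exact: (integrable_fin_num _ (L2dot_integrable F F)).
have mF := measurable_Lspace F.
apply: ae_eq_integral => //.
- by apply/measurable_EFinP; exact: measurable_funM.
- by apply/measurable_EFinP; exact: measurable_funX.
- by apply: filterS Ff => x /(_ I) Ffx _; rewrite Ffx expr2.
Qed.

Lemma mem_Lfun2 f : measurable_fun setT f ->
  (\int[mu]_x (f x ^+ 2)%:E < +oo)%E -> f \in Lfun mu 2.
Proof.
move=> mf foo; rewrite inE; apply/andP; split; rewrite inE //=.
rewrite /finite_norm; apply: (@lty_poweRy _ _ 2) => //.
rewrite powR_Lnorm //; apply: le_lt_trans foo.
rewrite le_eqVlt; apply/orP; left; apply/eqP; apply: eq_integral => x _ /=.
by rewrite powR_mulrn // real_normK ?num_real.
Qed.

Lemma L2dotE F G f g : measurable_fun setT f -> measurable_fun setT g ->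
  (F : T -> R) = f %[ae mu] -> (G : T -> R) = g %[ae mu] ->
  L2dot F G = \int[mu]_x (f x * g x).
Proof.
move=> mf mg Ff Gg; rewrite /L2dot /Rintegral; congr fine.
have mF := measurable_Lspace F; have mG := measurable_Lspace G.
apply: ae_eq_integral => //.
- by apply/measurable_EFinP; exact: measurable_funM.
- by apply/measurable_EFinP; exact: measurable_funM.
- by apply: (filterS _ (filterI Ff Gg)) => x [/(_ I) -> /(_ I) ->].
Qed.

Lemma ae_eqD F G f g : (F : T -> R) = f %[ae mu] -> (G : T -> R) = g %[ae mu] ->
  ((F + G : L) : T -> R) = (fun x => f x + g x) %[ae mu].
Proof.
move=> Ff Gg; apply: (filterS _ (filterI (LspaceDE F G) (filterI Ff Gg))).
by move=> x [-> [/(_ I) -> /(_ I) ->]].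
Qed.

Lemma ae_eqZ (a : R) F f : (F : T -> R) = f %[ae mu] ->
  ((a *: F : L) : T -> R) = (fun x => a * f x) %[ae mu].
Proof.
move=> Ff; apply: (filterS _ (filterI (LspaceZE a F) Ff)).
by move=> x [-> /(_ I) ->].
Qed.

Lemma ae_eqB F G f g : (F : T -> R) = f %[ae mu] -> (G : T -> R) = g %[ae mu] ->
  ((F - G : L) : T -> R) = (fun x => f x - g x) %[ae mu].
Proof.
move=> Ff Gg; have := ae_eqD Ff (ae_eqZ (-1) Gg); rewrite scaleN1r.
by apply: filterS => x /[apply] ->; rewrite mulN1r.
Qed.

Lemma ae_eq_sum (I : Type) (r : seq I) (F : I -> L) (f : I -> T -> R) :
  (forall i, (F i : T -> R) = f i %[ae mu]) ->
  ((\sum_(i <- r) F i : L) : T -> R) = (fun x => \sum_(i <- r) f i x) %[ae mu].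
Proof.
move=> Ff; elim: r => [|i r IH].
  by rewrite big_nil; apply: filterS (Lspace0E mu (lee1n 2)) => x -> _; rewrite big_nil.
rewrite big_cons; have := ae_eqD (Ff i) IH.
by apply: filterS => x /[apply] ->; rewrite big_cons.
Qed.

Hypothesis mu_fin : (mu setT < +oo)%E.

Lemma bounded_mem_Lfun2 f (M : R) : measurable_fun setT f ->
  (forall x, `|f x| <= M) -> f \in Lfun mu 2.
Proof.
move=> mf fM; apply: mem_Lfun2 => //.
apply: (@le_lt_trans _ _ (\int[mu]_x (M ^+ 2)%:E)%E).
  apply: ge0_le_integral => //.
  - by move=> x _; rewrite lee_fin sqr_ge0.
  - by apply/measurable_EFinP; exact: measurable_funX.
  - move=> x _; rewrite lee_fin -[leLHS]real_normK ?num_real //.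
    by rewrite lerXn2r ?nnegrE // (le_trans _ (fM x)).
rewrite integral_cst // ltey_eq fin_numM //.
by rewrite ge0_fin_numE.
Qed.

Lemma L2norm_bounded F f (M : R) : measurable_fun setT f ->
  (F : T -> R) = f %[ae mu] -> (forall x, `|f x| <= M) ->
  `|F| ^+ 2 <= M ^+ 2 * fine (mu setT).
Proof.
move=> mf Ff fM; rewrite -lee_fin (L2norm_sqr mf Ff) EFinM fineK; last first.
  by rewrite ge0_fin_numE.
rewrite -integral_cst //; apply: ge0_le_integral => //.
- by move=> x _; rewrite lee_fin sqr_ge0.
- by apply/measurable_EFinP; exact: measurable_funX.
- move=> x _; rewrite lee_fin -[leLHS]real_normK ?num_real //.
  by rewrite lerXn2r ?nnegrE // (le_trans _ (fM x)).
Qed.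

End L2_classes.

(** * Completeness of L^2 over a finite measure *)

Section L2_complete.
Context d (T : measurableType d) (R : realType).
Variable mu : {measure set T -> \bar R}.
Local Notation L := (LspaceType mu (lee1n 2)).
Implicit Types (f g h : T -> R) (F G : L).

(** Fatou's lemma for the squares. A bound from index N on suffices, because the lower limit ignores
    initial terms. *)
Lemma fatou_sqr (S : nat -> T -> R) g h (t : R) (N : nat) :
  (forall n, measurable_fun setT (S n)) -> measurable_fun setT h ->
  (forall x, S n x @[n --> \oo] --> g x) ->
  (forall n, (N <= n)%N -> (\int[mu]_x ((S n x - h x) ^+ 2)%:E <= t%:E)%E) ->
  (\int[mu]_x ((g x - h x) ^+ 2)%:E <= t%:E)%E.
Proof.
move=> mS mh Sg St.
have -> : (\int[mu]_x ((g x - h x) ^+ 2)%:E =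
    \int[mu]_x (limn_einf (fun n => ((S n x - h x) ^+ 2)%:E)))%E.
  apply: eq_integral => x _.
  have Sgx : ((S n x - h x) ^+ 2)%:E @[n --> \oo] --> ((g x - h x) ^+ 2)%:E.
    apply: cvg_EFin; first exact: nearW.
    rewrite /=.
    have Sh : S n x - h x @[n --> \oo] --> g x - h x.
      by apply: cvgB; [exact: Sg|exact: cvg_cst].
    by rewrite expr2; under eq_fun do rewrite expr2; exact: cvgM.
  by rewrite is_cvg_limn_einfE; [apply/esym/cvg_lim|apply/cvg_ex; eexists; exact: Sgx].
apply: le_trans.
  apply: fatou => //.
    move=> n; apply/measurable_EFinP; apply: measurable_funX.
    exact: measurable_funB.
  by move=> n x _; rewrite lee_fin sqr_ge0.
rewrite limn_einf_lim; apply: lime_le; first exact: is_cvg_einfs.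
apply: nearW => n; apply: le_trans (St (n + N)%N (leq_addl _ _)).
by apply: ereal_inf_lbound; exists (n + N)%N => //=; rewrite leq_addr.
Qed.

Hypothesis mu_fin : (mu setT < +oo)%E.

(** Integrate |F| <= b / 2 + F^2 / (2 b): the second term contributes at most b / 2. A free positive
    [b] stands in for the norm, which may vanish. *)
Lemma L1_le_L2 F (b : R) : `|F| <= b -> 0 < b ->
  (\int[mu]_x `|F x|%:E <= (b * (fine (mu setT) + 1) / 2)%:E)%E.
Proof.
move=> Fb b0; have mF := measurable_Lspace F.
have muE : (fine (mu setT))%:E = mu setT by rewrite fineK // ge0_fin_numE.
apply: (@le_trans _ _ (\int[mu]_x ((b / 2)%:E + (2 * b)^-1%:E * (F x ^+ 2)%:E))%E).
  apply: ge0_le_integral => //.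
  - by apply/measurable_EFinP; exact: measurableT_comp.
  - apply: emeasurable_funD; first exact: measurable_cst.
    apply: emeasurable_funM; first exact: measurable_cst.
    by apply/measurable_EFinP; exact: measurable_funX.
  - move=> x _; rewrite -EFinM -EFinD lee_fin -[F x ^+ 2]real_normK ?num_real //.
    rewrite -subr_ge0.
    have -> : b / 2 + (2 * b)^-1 * `|F x| ^+ 2 - `|F x| = (`|F x| - b) ^+ 2 / (2 * b).
      by field; rewrite gt_eqF.
    by rewrite divr_ge0 ?sqr_ge0 // mulr_ge0 // ltW.
rewrite ge0_integralD //; last 3 first.
- by move=> x _; rewrite lee_fin divr_ge0 // ltW.
- by move=> x _; rewrite mule_ge0 // lee_fin ?sqr_ge0 // invr_ge0 mulr_ge0 // ltW.
- apply: emeasurable_funM; first exact: measurable_cst.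
  by apply/measurable_EFinP; exact: measurable_funX.
rewrite integral_cst // -muE ge0_integralZl //; last 3 first.
- by apply/measurable_EFinP; exact: measurable_funX.
- by move=> x _; rewrite lee_fin sqr_ge0.
- by rewrite lee_fin invr_ge0 mulr_ge0 // ltW.
rewrite -(@L2norm_sqr _ _ _ mu F F) //; last exact: ae_eq_refl.
rewrite -!EFinM -EFinD lee_fin.
have : `|F| ^+ 2 <= b ^+ 2 by rewrite lerXn2r ?nnegrE // ltW.
rewrite -(ler_pM2l (_ : 0 < (2 * b)^-1)) ?invr_gt0 ?mulr_gt0 //.
move=> /(lerD (lexx (b / 2 * fine (mu setT)))) /le_trans; apply.
rewrite le_eqVlt; apply/orP; left; apply/eqP.
by field; rewrite gt_eqF.
Qed.

(** The Riesz-Fischer argument. As the measure is finite, the L^1 norms are summable too, so the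
    pointwise series converges absolutely almost everywhere; Fatou then bounds the L^2 distance from
    its sum to a partial sum by the tail of the norms. *)
Lemma L2_absolutely_cvg (u : nat -> L) :
  cvgn (series (fun n => `|u n|)) -> cvgn (series u).
Proof.
move=> cu; pose s := limn (series (fun n => `|u n|)).
have us n : \sum_(i < n) `|u i| <= s.
  rewrite -(big_mkord xpredT (fun i => `|u i|)); apply: nondecreasing_cvgn_le => //.
  by apply: nondecreasing_series => k _ _.
have mu_ n : measurable_fun setT (u n : T -> R) by exact: measurable_Lspace.
have mau n : measurable_fun setT (fun x => `|u n x|%:E).
  by apply/measurable_EFinP; exact: measurableT_comp.
pose hs x := (\sum_(n <oo) `|u n x|%:E)%E.
have mhs : measurable_fun setT hs.
  by apply: ge0_emeasurable_sum => // n x _ _; rewrite lee_fin.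
pose C : R := (fine (mu setT) + 1) / 2.
have C0 : 0 <= C by rewrite divr_ge0 // addr_ge0 // fine_ge0.
have ihs : (\int[mu]_x hs x < +oo)%E.
  rewrite integral_nneseries //.
  apply: (@le_lt_trans _ _ ((s + 2) * C)%:E); last exact: ltry.
  apply: lime_le; first by apply: is_cvg_nneseries => n _ _; exact: integral_ge0.
  apply: nearW => n; rewrite /= big_mkord.
  (* The summand 2^-i keeps the bound positive, as [L1_le_L2] demands, and adds at most 2 in total,
     hence s + 2. *)
  apply: (@le_trans _ _ (\sum_(i < n) ((`|u i| + 2^-1 ^+ i) * C)%:E)%E).
    apply: lee_sum => i _; rewrite /C mulrA; apply: L1_le_L2.
      by rewrite lerDl exprn_ge0.
    by rewrite ltr_wpDl // exprn_gt0.
  rewrite sumEFin lee_fin -mulr_suml ler_wpM2r // big_split /=.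
  apply: lerD; first exact: us.
  have -> : \sum_(i < n) 2^-1 ^+ i = 2 - 2 * 2^-1 ^+ n :> R.
    elim: n => [|n IH]; first by rewrite big_ord0 expr0 mulr1 subrr.
    by rewrite big_ord_recr /= IH exprS; field.
  by rewrite gerBl mulr_ge0 // exprn_ge0.
have A_ae : {ae mu, forall x, (hs x < +oo)%E}.
  have ihs' : mu.-integrable setT hs.
    apply/integrableP; split => //.
    rewrite (_ : (fun x => _) = hs) //; apply/funext => x.
    by rewrite gee0_abs // nneseries_ge0.
  have := integrable_ae measurableT ihs'.
  apply: filterS => x /(_ I); rewrite fin_numE => /andP[_].
  by rewrite ltey.
pose A := [set x | (hs x < +oo)%E].
have mA : measurable A.
  have := emeasurable_fun_infty_o measurableT mhs +oo%E.
  by rewrite setTI.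
(* Representatives vanishing off A, so that the series converges at every point. *)
pose f n x := u n x * \1_A x.
have mf n : measurable_fun setT (f n).
  by apply: measurable_funM => //; exact: measurable_indic.
have uf n : (u n : T -> R) = f n %[ae mu].
  by apply: filterS A_ae => x Ax _; rewrite /f indicE mem_set // mulr1.
have cf x : cvgn (series (f ^~ x)).
  have [Ax|Ax] := pselect (A x); last first.
    apply/cvg_ex; exists 0; apply: cvg_near_cst; apply: nearW => n.
    by rewrite /series /= big1 // => i _; rewrite /f indicE memNset // mulr0.
  apply: normed_cvg; apply: nondecreasing_is_cvgn.
    by apply: nondecreasing_series => k _ _ /=.
  exists (fine (hs x)) => _ [n _ <-]; rewrite /series /=.
  rewrite -lee_fin fineK; last first.
    by rewrite ge0_fin_numE // nneseries_ge0.
  rewrite -sumEFin; apply: le_trans (nneseries_lim_ge n _) => //.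
  by apply: lee_sum => i _; rewrite /f indicE mem_set // mulr1.
pose S n x := series (f ^~ x) n.
pose g x := limn (series (f ^~ x)).
have mS n : measurable_fun setT (S n).
  by rewrite /S /series /=; apply: measurable_sum.
have mg : measurable_fun setT g.
  by apply: (measurable_fun_cvg (h := S)) => // x _; exact: cf.
have SE n : (series u n : T -> R) = S n %[ae mu].
  by rewrite /series /=; exact: ae_eq_sum.
have gS N : (\int[mu]_x ((g x - S N x) ^+ 2)%:E <=
    ((s - series (fun n => `|u n|) N) ^+ 2)%:E)%E.
  apply: (@fatou_sqr S g (S N) _ N) => // n Nn.
  rewrite -(L2norm_sqr _ (ae_eqB (SE n) (SE N))); last exact: measurable_funB.
  rewrite lee_fin lerXn2r ?nnegrE //.
    by rewrite subr_ge0 /series /= big_mkord.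
  rewrite sub_series_geq // (le_trans (ler_norm_sum _ _ _)) //.
  by rewrite -sub_series_geq // lerD2r /series /= big_mkord.
have gL : g \in Lfun mu 2.
  apply: mem_Lfun2 => //; apply: le_lt_trans (ltry ((s - series (fun n => `|u n|) 0) ^+ 2)).
  apply: le_trans (gS 0%N); rewrite le_eqVlt; apply/orP; left; apply/eqP.
  by apply: eq_integral => x _; rewrite /S /series /= big_geq // subr0.
pose U := Lclass (lee1n 2) gL.
apply/cvg_ex; exists U; apply/cvgrPdist_le => eps eps0.
have : s - series (fun n => `|u n|) n @[n --> \oo] --> s - s.
  by apply: cvgB; [exact: cvg_cst|exact: cu].
rewrite subrr => /cvgrPdist_le/(_ _ eps0); apply: filterS => n.
rewrite sub0r normrN => sn.
have sn0 : 0 <= s - series (fun n => `|u n|) n.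
  by rewrite subr_ge0 /series /= big_mkord.
rewrite ger0_norm // in sn; apply: le_trans sn.
rewrite -(@ler_pXn2r _ 2) ?nnegrE // -lee_fin.
rewrite (L2norm_sqr _ (ae_eqB (LclassE (lee1n 2) gL) (SE n))); last exact: measurable_funB.
exact: gS.
Qed.

End L2_complete.

(** * The orthonormal cosine system in L^2(0, pi) *)

Section L2_0pi.
Context (R : realType).
Local Notation mu := (lebesgue_0pi R).
Implicit Types (f g h p : R -> R) (F G : L2_0pi R).

Lemma lebesgue_0pi_setT : mu setT = pi%:E.
Proof.
rewrite /lebesgue_0pi /= /mrestr setTI lebesgue_measure_itv /= lte_fin pi_gt0.
by rewrite oppr0 adde0.
Qed.

Lemma lebesgue_0pi_fin : (mu setT < +oo)%E.
Proof. by rewrite lebesgue_0pi_setT ltry. Qed.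

Lemma integral_0pi (f : R -> \bar R) : measurable_fun setT f ->
  (\int[mu]_x f x = \int[@lebesgue_measure R]_(x in `]0%R, pi[) f x)%E.
Proof.
have ge0_case (g : R -> \bar R) : measurable_fun setT g -> (forall x, 0 <= g x)%E ->
    (\int[mu]_x g x = \int[@lebesgue_measure R]_(x in `]0%R, pi[) g x)%E.
  move=> mg g0.
  rewrite (@ge0_negligible_integral _ _ _ mu setT (~` `]0, pi[%classic) g) //.
  - rewrite setDE setCK setTI; apply: eq_measure_integral => A mA AD.
    by rewrite /lebesgue_0pi /= /mrestr setIidl.
  - exact: measurableC.
  - by rewrite /lebesgue_0pi /= /mrestr setICl measure0.
move=> mf; rewrite integralE [RHS]integralE; congr (_ - _)%E.
  by apply: ge0_case => //; exact: measurable_funepos.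
by apply: ge0_case => //; exact: measurable_funeneg.
Qed.

Lemma Rintegral_0pi_FTC f p : (forall x : R, is_derive x 1 p (f x)) -> continuous f ->
  \int[mu]_x f x = p pi - p 0.
Proof.
move=> dp cf; rewrite /Rintegral integral_0pi; last first.
  by apply/measurable_EFinP; exact: continuous_measurable_fun.
have cp : continuous p.
  move=> x; apply/differentiable_continuous/derivable1_diffP.
  exact: (@ex_derive _ _ _ _ _ _ _ (dp x)).
rewrite (_ : (\int[@lebesgue_measure R]_(x in `]0%R, pi[) (f x)%:E =
   \int[@lebesgue_measure R]_(x in `[0%R, pi]) (f x)%:E)%E); last first.
  have mf (i : interval R) : measurable_fun [set` i] (fun x => (f x)%:E).
    by apply/measurable_EFinP; apply: measurable_funTS; exact: continuous_measurable_fun.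
  by rewrite integral_itv_bndo_bndc // integral_itv_obnd_cbnd.
rewrite (@continuous_FTC2 _ f p) ?pi_gt0 //.
- exact: continuous_subspaceT.
- split.
  + by move=> x _; exact: (@ex_derive _ _ _ _ _ _ _ (dp x)).
  + by apply: cvg_at_right_filter; exact: cp.
  + by apply: cvg_at_left_filter; exact: cp.
- by move=> x _; rewrite derive1E; exact: (@derive_val _ _ _ _ _ _ _ (dp x)).
Qed.

Lemma sin_natpi (n : nat) : sin (n%:R * pi) = 0 :> R.
Proof. by rewrite -[X in sin X]add0r mulr_natl (alternatingn (@sinDpi R)) sin0 mulr0. Qed.

Lemma continuous_cos_affine (r : R) : continuous (fun x => cos (r * x)).
Proof.
move=> x; apply: (@continuous_comp _ _ _ (fun x => r * x) cos).
  by apply: cvgM; [exact: cvg_cst|exact: cvg_id].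
exact: continuous_cos.
Qed.

Lemma is_derive_sin_scale (r x : R) : r != 0 ->
  is_derive x 1 (fun x => sin (r * x) / r) (cos (r * x)).
Proof.
by move=> r0; apply: is_derive_eq; rewrite /GRing.scale /=; field.
Qed.

Lemma Rintegral_cos_cos (j k : nat) :
  \int[mu]_x (cos (j%:R * x) * cos (k%:R * x)) =
  if j == k then (if j == 0%N then pi else pi / 2) else 0.
Proof.
have cc : continuous (fun x : R => cos (j%:R * x) * cos (k%:R * x)).
  by move=> x; apply: cvgM; exact: continuous_cos_affine.
case: (eqVneq j k) cc => [<-|jk] cc.
  have [j0|j0] := eqVneq j 0%N.
    have d (x : R) : is_derive x 1 id (cos (j%:R * x) * cos (j%:R * x)).
      by rewrite j0 mul0r cos0 mulr1; exact: is_derive_id.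
    by rewrite (Rintegral_0pi_FTC d cc) subr0.
  have r0 : (2 * j%:R : R) != 0 by rewrite mulf_neq0 // pnatr_eq0.
  have d (x : R) : is_derive x 1
      (fun x => 2^-1 * (x + sin (2 * j%:R * x) / (2 * j%:R)))
      (cos (j%:R * x) * cos (j%:R * x)).
    have d1 := is_derive_sin_scale x r0.
    apply: is_derive_eq; rewrite /GRing.scale /=.
    have -> : 2 * j%:R * x = j%:R * x + j%:R * x by ring.
    have := cos2Dsin2 (j%:R * x); rewrite cosD; set c := cos _; set s := sin _.
    by move=> cs; have -> : s * s = 1 - c * c; [rewrite -cs; ring|field].
  rewrite (Rintegral_0pi_FTC d cc) -natrM sin_natpi mulr0 sin0 !mul0r !addr0.
  by rewrite mulr0 subr0 mulrC.
have rB : (j%:R - k%:R : R) != 0 by rewrite subr_eq0 eqr_nat.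
have rD : (j%:R + k%:R : R) != 0.
  by rewrite -natrD pnatr_eq0 addn_eq0; apply: contra jk => /andP[/eqP -> /eqP ->].
have d (x : R) : is_derive x 1 (fun x => 2^-1 *
    (sin ((j%:R - k%:R) * x) / (j%:R - k%:R) + sin ((j%:R + k%:R) * x) / (j%:R + k%:R)))
    (cos (j%:R * x) * cos (k%:R * x)).
  have d1 := is_derive_sin_scale x rB; have d2 := is_derive_sin_scale x rD.
  apply: is_derive_eq; rewrite /GRing.scale /=.
  by rewrite mulrBl mulrDl cosB cosD; field.
have s1 : sin ((j%:R - k%:R) * pi) = 0 :> R.
  by rewrite mulrBl sinB !sin_natpi mulr0 mul0r subr0.
have s2 : sin ((j%:R + k%:R) * pi) = 0 :> R by rewrite -natrD sin_natpi.
by rewrite (Rintegral_0pi_FTC d cc) s1 s2 !mulr0 sin0 !mul0r addr0 mulr0 subr0.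
Qed.

Definition cos_norm (k : nat) : R :=
  if k == 0%N then (Num.sqrt pi)^-1 else Num.sqrt (2 / pi).

Lemma cos_norm_gt0 k : 0 < cos_norm k.
Proof.
rewrite /cos_norm; case: ifP => _; first by rewrite invr_gt0 sqrtr_gt0 pi_gt0.
by rewrite sqrtr_gt0 divr_gt0 // pi_gt0.
Qed.

Lemma cos_basis_Lfun k : (fun x => cos_norm k * cos (k%:R * x)) \in Lfun mu 2.
Proof.
apply: (@bounded_mem_Lfun2 _ _ _ _ lebesgue_0pi_fin _ (cos_norm k)).
  apply: continuous_measurable_fun => x; apply: cvgM; first exact: cvg_cst.
  exact: continuous_cos_affine.
by move=> x; rewrite normrM gtr0_norm ?cos_norm_gt0 // ler_piMr ?cos_max // ltW ?cos_norm_gt0.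
Qed.

Definition cos_basis (k : nat) : L2_0pi R := Lclass (lee1n 2) (cos_basis_Lfun k).

Lemma cos_basisE k :
  (cos_basis k : R -> R) = (fun x => cos_norm k * cos (k%:R * x)) %[ae mu].
Proof. exact: LclassE. Qed.

Lemma measurable_cos_scale (c r : R) : measurable_fun setT (fun x => c * cos (r * x)).
Proof.
apply: continuous_measurable_fun => x; apply: cvgM; first exact: cvg_cst.
exact: continuous_cos_affine.
Qed.

Lemma cos_basis_orthonormal : orthonormal_seq (L2dot (mu := mu)) cos_basis.
Proof.
move=> i j.
transitivity (\int[mu]_x (cos_norm i * cos (i%:R * x) * (cos_norm j * cos (j%:R * x)))).
  exact: (@L2dotE _ _ _ mu (cos_basis i) (cos_basis j) _ _
    (measurable_cos_scale _ _) (measurable_cos_scale _ _) (cos_basisE i) (cos_basisE j)).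
have -> : (fun x => cos_norm i * cos (i%:R * x) * (cos_norm j * cos (j%:R * x))) =
    (fun x => (cos_norm i * cos_norm j) * (cos (i%:R * x) * cos (j%:R * x))) :> (R -> R).
  by apply/funext => x; ring.
rewrite RintegralZl //; last first.
  apply/Lfun1_integrable; apply: Lfun2_mul_Lfun1.
    apply: (@bounded_mem_Lfun2 _ _ _ _ lebesgue_0pi_fin _ 1) => [|x]; last exact: cos_max.
    by apply: continuous_measurable_fun; exact: continuous_cos_affine.
  apply: (@bounded_mem_Lfun2 _ _ _ _ lebesgue_0pi_fin _ 1) => [|x]; last exact: cos_max.
  by apply: continuous_measurable_fun; exact: continuous_cos_affine.
rewrite Rintegral_cos_cos; have [<-|_] := eqVneq i j; last by rewrite mulr0.
rewrite /cos_norm; case: ifP => _.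
  rewrite -expr2 exprVn sqr_sqrtr ?pi_ge0 // mulVf // gt_eqF ?pi_gt0 //.
rewrite -expr2 sqr_sqrtr ?divr_ge0 ?pi_ge0 //.
by rewrite mulrA divfK ?gt_eqF ?pi_gt0 // divff.
Qed.

End L2_0pi.

(** * Completeness of the cosine system *)

Section cos_complete.
Context (R : realType).
Local Notation mu := (lebesgue_0pi R).
Implicit Types (f g h p : R -> R) (F G : L2_0pi R).

Definition truncate M x : R := Num.max (Num.min x M) (- M).

Lemma truncate_bound M x : 0 <= M -> `|truncate M x| <= M.
Proof.
move=> M0; rewrite /truncate ler_norml le_max lexx orbT /= ge_max ge_min lexx orbT /=.
by rewrite (le_trans _ M0) // oppr_le0.
Qed.

Lemma truncate_lipschitz M x y : `|truncate M x - truncate M y| <= `|x - y|.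
Proof. exact: le_trans (max_lipschitz _ _ _) (min_lipschitz _ _ _). Qed.

Lemma truncate_id M x : `|x| <= M -> truncate M x = x.
Proof.
by rewrite ler_norml => /andP[Mx xM]; rewrite /truncate min_l // max_l.
Qed.

Lemma truncate_dist M x : 0 <= M -> `|x - truncate M x| <= `|x|.
Proof.
move=> M0; have := ler_norm x; have := ler_norm (- x); rewrite normrN.
rewrite ler_norml /truncate; move: `|x| => z.
case: (leP x M) => xM.
  by case: (leP x (- M)) => ? ? ?; apply/andP; split; lra.
by case: (leP M (- M)) => ? ? ?; apply/andP; split; lra.
Qed.

Lemma continuous_truncate M : continuous (truncate M).
Proof.
apply: (@lipschitz_continuous R R R _ 1) => x y.
by rewrite mul1r truncate_lipschitz.
Qed.

(** Dominated convergence: at each x the error is 0 once M exceeds |F x|, and F^2 is a majorant. *)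
Lemma L2_truncate F (eps : R) : 0 < eps -> exists2 M, 0 < M &
  (\int[mu]_x ((F x - truncate M (F x)) ^+ 2)%:E < eps%:E)%E.
Proof.
move=> eps0; have mF := measurable_Lspace F.
have mtr M : measurable_fun setT (fun x => truncate M (F x)).
  apply: (measurableT_comp _ mF); apply: continuous_measurable_fun.
  exact: continuous_truncate.
have mFtr n : measurable_fun setT (fun x => ((F x - truncate n%:R (F x)) ^+ 2)%:E).
  by apply/measurable_EFinP; apply: measurable_funX; exact: measurable_funB.
have [|||||_ _] := @dominated_convergence _ _ R mu setT measurableT
  (fun n x => ((F x - truncate n%:R (F x)) ^+ 2)%:E) (fun=> 0%:E)
  (fun x => (F x * F x)%:E).
- exact: mFtr.
- exact: measurable_cst.
- apply: nearW => x _; apply: cvg_near_cst.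
  exists (Num.truncn `|F x|).+1 => // n /= nF.
  rewrite truncate_id ?subrr ?expr0n // ltW // (lt_le_trans (Num.Theory.truncnS_gt _)) //.
  by rewrite ler_nat.
- exact: L2dot_integrable.
- apply: nearW => x n _; rewrite gee0_abs lee_fin ?sqr_ge0 //.
  rewrite -expr2 -[leLHS]real_normK ?num_real // -[leRHS]real_normK ?num_real //.
  rewrite lerXn2r ?nnegrE //.
  exact: truncate_dist.
rewrite integral0 => cvg0.
have [N _ HN] := cvg0 _ (@open_ereal_lt' R 0%E eps%:E eps0).
exists N.+1%:R; first by rewrite ltr0n.
exact: (HN N.+1 (leqnSn N)).
Qed.

Lemma ae_0pi (P : R -> Prop) : (forall x, 0 < x < pi -> P x) ->
  {ae mu, forall x, P x}.
Proof.
move=> HP; exists (~` `]0, pi[%classic); split.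
- exact: measurableC.
- by rewrite /lebesgue_0pi /= /mrestr setICl measure0.
- by move=> x /= nP xpi; apply: nP; apply: HP; move: xpi; rewrite in_itv.
Qed.

(** A truncation f of F is approximated in L^1 by a continuous g. Truncating g to h at the same
    level M upgrades this to L^2, since |f - h|^2 <= 2 M |f - g|. *)
Lemma continuous_dense F (eps : R) : 0 < eps -> exists M h,
  [/\ continuous h, forall x, `|h x| <= M &
   forall G, (G : R -> R) = h %[ae mu] -> `|F - G| <= eps].
Proof.
move=> eps0; have mF := measurable_Lspace F.
have e0 : 0 < (eps / 2) ^+ 2 by rewrite exprn_gt0 // divr_gt0.
have [M M0 FM] := L2_truncate F e0.
pose f x := truncate M (F x).
have mf : measurable_fun setT f.
  apply: (measurableT_comp _ mF); apply: continuous_measurable_fun.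
  exact: continuous_truncate.
have fM x : `|f x| <= M by rewrite truncate_bound // ltW.
have muI : (@lebesgue_measure R `]0%R, pi[%classic < +oo)%E.
  by rewrite lebesgue_measure_itv /= lte_fin pi_gt0 -EFinB ltry.
have intf : (@lebesgue_measure R).-integrable `]0%R, pi[ (EFin \o f).
  apply: measurable_bounded_integrable => //.
    exact: measurable_funTS.
  by exists M; split; rewrite ?num_real // => y My x _; exact: le_trans (fM x) (ltW My).
have [g_ [cg_ _ fg_]] := approximation_continuous_integrable (measurable_itv _) muI intf.
(* The L^1 error whose product with 2 M is the square of eps / 2. *)
have d0 : 0 < (eps / 2) ^+ 2 / (2 * M) by rewrite divr_gt0 // mulr_gt0.
have [n fgn] : exists n, (\int[lebesgue_measure]_(z in `]0%R, pi[) `|(f z - g_ n z)%:E|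
    < ((eps / 2) ^+ 2 / (2 * M))%:E)%E.
  have [N _ HN] := fg_ _ (@open_ereal_lt' R 0%E ((eps / 2) ^+ 2 / (2 * M))%:E d0).
  by exists N; exact: (HN N (leqnn N)).
pose g := g_ n; pose h x := truncate M (g x).
have ch : continuous h.
  move=> x; apply: (@continuous_comp _ _ _ g (truncate M)); first exact: cg_.
  exact: continuous_truncate.
exists M, h; split=> // [x|G Gh]; first by rewrite truncate_bound // ltW.
have mfg : measurable_fun setT (fun x => `|(f x - g x)%:E|%E).
  apply: measurableT_comp => //; apply/measurable_EFinP; apply: measurable_funB => //.
  by apply: continuous_measurable_fun; exact: cg_.
have mh : measurable_fun setT h by exact: continuous_measurable_fun.
have fL : f \in Lfun mu 2 by exact: (bounded_mem_Lfun2 (lebesgue_0pi_fin R) mf fM).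
have G1f := LclassE (lee1n 2) fL; set G1 := Lclass _ fL in G1f.
rewrite -(subrKA G1) (le_trans (ler_normD _ _)) // [leRHS](splitr eps).
have eps2 : 0 <= eps / 2 by rewrite ltW // divr_gt0.
apply: lerD.
  rewrite -(@ler_pXn2r _ 2) ?nnegrE // -lee_fin.
  rewrite (L2norm_sqr _ (ae_eqB (ae_eq_refl _ _ _) G1f)); last exact: measurable_funB.
  exact: ltW.
rewrite -(@ler_pXn2r _ 2) ?nnegrE // -lee_fin.
rewrite (L2norm_sqr _ (ae_eqB G1f Gh)); last exact: measurable_funB.
rewrite integral_0pi; last first.
  by apply/measurable_EFinP; apply: measurable_funX; exact: measurable_funB.
apply: (@le_trans _ _ (\int[lebesgue_measure]_(z in `]0%R, pi[)
    ((2 * M)%:E * `|(f z - g z)%:E|))%E).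
  apply: ge0_le_integral => //.
  - by move=> x _; rewrite lee_fin sqr_ge0.
  - apply/measurable_EFinP; apply: measurable_funTS.
    by apply: measurable_funX; exact: measurable_funB.
  - apply: emeasurable_funM; first exact: measurable_cst.
    exact: measurable_funTS.
  - move=> x _; rewrite -EFinM lee_fin -[leLHS]real_normK ?num_real // expr2.
    have fh : `|f x - h x| <= `|f x - g x|.
      by rewrite -[f x in leLHS](truncate_id (fM x)) truncate_lipschitz.
    apply: ler_pM => //; rewrite (le_trans (ler_normB _ _)) // mulr2n mulrDl mul1r.
    by rewrite lerD // truncate_bound // ltW.
rewrite ge0_integralZl //; last 2 first.
- exact: measurable_funTS.
- by rewrite lee_fin mulr_ge0 // ltW.
rewrite -lee_pdivlMl ?mulr_gt0 // -EFinM mulrC.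
exact: ltW.
Qed.

Lemma cos_poly_span p : cos_poly p -> exists n (c : nat -> R),
  ((\sum_(i < n) c i *: cos_basis R i : L2_0pi R) : R -> R) = p %[ae mu].
Proof.
move=> [n [c pE]]; exists n, (fun i => c i / cos_norm R i).
have := @ae_eq_sum _ _ R mu _ (index_enum 'I_n)
  (fun i : 'I_n => (c i / cos_norm R i) *: cos_basis R i) _
  (fun i => ae_eqZ (c i / cos_norm R i) (cos_basisE R i)).
apply: filterS => x /(_ I) -> _; rewrite pE; apply: eq_bigr => i _.
by rewrite mulrA divfK // gt_eqF // cos_norm_gt0.
Qed.

Lemma cos_poly_continuous p : cos_poly p -> continuous p.
Proof.
move=> [n [c pE]]; have -> : p = fun t => \sum_(j < n) c j * cos (j%:R * t).
  by apply/funext.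
elim: n {pE} => [|n IH].
  by under eq_fun do rewrite big_ord0; move=> x; exact: cvg_cst.
under eq_fun do rewrite big_ord_recr /=.
move=> x; apply: cvgD; first exact: IH.
apply: cvgM; first exact: cvg_cst.
exact: continuous_cos_affine.
Qed.

(** On (0, pi) a continuous h agrees with h (acos (cos x)), to which uniform approximation by cosine
    polynomials applies. *)
Lemma cos_basis_complete : complete_seq (@cos_basis R).
Proof.
apply/seteqP; split=> // F _ B /nbhs_ballP[eps /= eps0 epsB].
have eps20 : 0 < eps / 2 by rewrite divr_gt0.
have [M [h [ch hM hF]]] := continuous_dense F eps20.
(* A uniform bound eta gives an L^2 norm of at most eta sqrt pi, and pi < 4 (pi + 1)^2 keeps this
   below eps / 2. *)
have eta0 : 0 < eps / (4 * (pi + 1)).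
  by rewrite divr_gt0 // mulr_gt0 // addr_gt0 // pi_gt0.
have [p pc hp] := cos_poly_dense ch eta0.
have [n [c cp]] := cos_poly_span pc.
exists (\sum_(i < n) c i *: cos_basis R i); split; first by exists n, c.
apply: epsB; rewrite -ball_normE /=; set P := \sum_(i < n) _ in cp *.
have hL : h \in Lfun mu 2.
  apply: (@bounded_mem_Lfun2 _ _ _ _ (lebesgue_0pi_fin R) _ M) => //.
  exact: continuous_measurable_fun.
have FG := hF _ (LclassE (lee1n 2) hL); set G := Lclass _ hL in FG.
have GE : (G : R -> R) = h %[ae mu] by exact: LclassE.
rewrite -(subrKA G) (le_lt_trans (ler_normD _ _)) // [ltRHS](splitr eps).
apply: ler_ltD => //.
have GP : ((G - P : L2_0pi R) : R -> R) = (fun x => h (acos (cos x)) - p x) %[ae mu].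
  have hcos : {ae mu, forall x, h (acos (cos x)) = h x}.
    by apply: ae_0pi => x /andP[x0 xpi]; rewrite cosK // in_itv /= !ltW.
  apply: (filterS _ (filterI (ae_eqB GE cp) hcos)) => x [/(_ I) -> ->].
  by [].
have cGP : continuous (fun x => h (acos (cos x)) - p x).
  move=> x; apply: cvgB; last exact: cos_poly_continuous.
  exact: continuous_acos_cos.
have := L2norm_bounded (lebesgue_0pi_fin R) (continuous_measurable_fun cGP) GP
  (fun x => ltW (hp x)).
rewrite lebesgue_0pi_setT /= => GPle.
rewrite -(@ltr_pXn2r _ 2) ?nnegrE // ?(ltW eps20) //; apply: (le_lt_trans GPle).
have pi0 := pi_gt0 R.
have piD : pi + 1 != 0 :> R by rewrite gt_eqF // addr_gt0.
have E (a b : R) : b + 1 != 0 -> (a / 2) ^+ 2 - (a / (4 * (b + 1))) ^+ 2 * b =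
   (a / (4 * (b + 1))) ^+ 2 * (4 * (b + 1) ^+ 2 - b).
  by move=> b0; field.
rewrite -subr_gt0 (E eps pi piD) mulr_gt0 ?exprn_gt0 //.
by move: (pi : R) pi0 => b b0; nra.
Qed.

End cos_complete.
(** * Fucik systems as triangular perturbations of the cosine basis *)

Section profile_facts.
Context (R : realType).
Implicit Types (A B p q s t x y : R).

Lemma cos_lipschitz x y : `|cos x - cos y| <= `|x - y|.
Proof.
wlog xy : x y / y <= x => [H|].
  have [yx|/ltW xy] := leP y x; first exact: H.
  by rewrite distrC [leRHS]distrC; exact: H.
have [z _ ->] := @MVT_segment R cos (fun z => - sin z) y x xy
  (fun z _ => is_derive_cos z) (continuous_subspaceT (@continuous_cos R)).
by rewrite normrM normrN ler_piMl // sin_max.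
Qed.

Lemma cos_min_pihalf_ge0 x : 0 <= x -> 0 <= cos (Num.min x (pi / 2)).
Proof.
move=> x0; have pi0 := pi_gt0 R; apply: cos_ge0_pihalf.
by rewrite ge_min lexx orbT andbT le_min; apply/andP; split; lra.
Qed.

Lemma fucik_profile_bound A B p q s : 0 <= A -> 0 <= B -> 0 <= p -> 0 <= q ->
  0 <= s <= pi -> `|fucik_profile A B p q s| <= Num.max A B.
Proof.
move=> A0 B0 p0 q0 /andP[s0 spi]; rewrite /fucik_profile.
have := @cos_min_pihalf_ge0 (p * s) (mulr_ge0 p0 s0).
have := @cos_min_pihalf_ge0 (q * (pi - s)).
rewrite mulr_ge0 ?subr_ge0 // => /(_ isT).
have := cos_le1 (Num.min (p * s) (pi / 2)).
have := cos_le1 (Num.min (q * (pi - s)) (pi / 2)).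
set c := cos _; set d := cos _ => d1 c1 d0 c0.
rewrite ler_norml lerNl !le_max; apply/andP; split; apply/orP; [right|left]; nra.
Qed.

(** On [0, pi], cos is the profile with all four parameters equal to 1, so the profiles are compared
    term by term. If q <= p, the constraints force B = 1 and A = q / p, hence 1 - q <= p - 1 and 1 -
    A <= 2 (p - 1); adding up gives the factor 2 + 2 pi. *)
Lemma fucik_profile_close A B p q s : 0 < A -> 0 < B -> 0 < p -> 0 < q ->
  Num.max A B = 1 -> A * p = B * q -> p^-1 + q^-1 = 2 -> 0 <= s <= pi ->
  `|fucik_profile A B p q s - cos s| <= (2 + 2 * pi) * (Num.max p q - 1).
Proof.
move=> A0 B0 p0 q0 AB ApBq pq2 /andP[s0 spi].
have pqE : p + q = 2 * (p * q).
  by rewrite -pq2; field; rewrite !gt_eqF.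
have cosE : cos s = cos (Num.min s (pi / 2)) - cos (Num.min (pi - s) (pi / 2)).
  have [sp|sp] := leP s (pi / 2).
    by rewrite min_r ?cos_pihalf ?subr0 //; lra.
  rewrite min_l; last by lra.
  by rewrite cos_pihalf sub0r cosB cospi sinpi mul0r addr0 mulN1r opprK.
pose K := `|A - 1| + `|B - 1| + pi * (`|p - 1| + `|q - 1|).
have pi0 := pi_gt0 R.
have half C r t : 0 < C -> 0 < r -> 0 <= t <= pi ->
    `|C * cos (Num.min (r * t) (pi / 2)) - cos (Num.min t (pi / 2))| <=
    `|C - 1| + `|r - 1| * pi.
  move=> C0 r0 /andP[t0 tpi].
  have -> : C * cos (Num.min (r * t) (pi / 2)) - cos (Num.min t (pi / 2)) =
    (C - 1) * cos (Num.min (r * t) (pi / 2)) +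
    (cos (Num.min (r * t) (pi / 2)) - cos (Num.min t (pi / 2))) by ring.
  rewrite (le_trans (ler_normD _ _)) // lerD //.
    by rewrite normrM ler_piMr // cos_max.
  rewrite (le_trans (cos_lipschitz _ _)) // (le_trans (min_lipschitz _ _ _)) //.
  have -> : r * t - t = (r - 1) * t by ring.
  by rewrite normrM ler_wpM2l // ger0_norm.
apply: (@le_trans _ _ K).
  rewrite cosE /fucik_profile.
  set a := A * _; set b := B * _; set c := cos _; set d := cos _.
  have -> : a - b - (c - d) = (a - c) - (b - d) by ring.
  rewrite (le_trans (ler_normB _ _)) // /K mulrDr addrACA lerD // [pi * _]mulrC.
    by apply: half => //; rewrite s0.
  by apply: half => //; rewrite subr_ge0 spi gerBl.
(* Exchanging (A, p) with (B, q) preserves the constraints, so the larger frequency may be assumed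
   to come first. *)
have wlogK A' B' p' q' : 0 < A' -> 0 < B' -> 0 < p' -> 0 < q' -> q' <= p' ->
    Num.max A' B' = 1 -> A' * p' = B' * q' -> p' + q' = 2 * (p' * q') ->
    `|A' - 1| + `|B' - 1| + pi * (`|p' - 1| + `|q' - 1|) <= (2 + 2 * pi) * (p' - 1).
  move=> {}A0 {}B0 {}p0 {}q0 qp {}AB {}ApBq {}pqE.
  have AB' : A' <= B' by rewrite -(ler_pM2r p0) ApBq ler_wpM2l // ltW.
  have B1 : B' = 1 by rewrite -AB max_r.
  have p1 : 1 <= p' by nra.
  have q1 : q' <= 1 by nra.
  have pq1 : 1 - q' <= p' - 1 by nra.
  have A1 : 1 - A' <= 2 * (p' - 1).
    rewrite -(ler_pM2r p0); rewrite B1 in ApBq; nra.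
  rewrite B1 subrr normr0 addr0 distrC ger0_norm ?subr_ge0 -?B1 // B1.
  rewrite ger0_norm ?subr_ge0 // [`|q' - 1|]distrC ger0_norm ?subr_ge0 //.
  move: (pi : R) pi0 => P P0; nra.
rewrite /K; have [qp|/ltW qp] := leP q p; first exact: wlogK.
rewrite [`|A - 1| + _]addrC [`|p - 1| + _]addrC; apply: wlogK => //.
- by rewrite maxC.
- by rewrite addrC pqE [q * p]mulrC.
Qed.

Lemma cos_min_le (x y : R) : 0 <= x -> x <= y ->
  cos (Num.min y (pi / 2)) <= cos (Num.min x (pi / 2)).
Proof.
move=> x0 xy; have pi0 := pi_gt0 R.
have pi20 : 0 <= pi / 2 :> R by lra.
have pi2pi : pi / 2 <= pi :> R by lra.
have mpi (z : R) : 0 <= z -> Num.min z (pi / 2) \in `[0, pi]%R.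
  move=> z0; rewrite in_itv /= le_min ge_min.
  by rewrite z0 pi20 pi2pi orbT.
rewrite leNgt ltr_cos ?mpi ?(le_trans x0) // -leNgt.
by rewrite le_min !ge_min xy lexx orbT.
Qed.

Lemma cos_min_lt (x y : R) : 0 <= x -> x < y -> x < pi / 2 ->
  cos (Num.min y (pi / 2)) < cos (Num.min x (pi / 2)).
Proof.
move=> x0 xy xpi; have pi0 := pi_gt0 R.
have pi20 : 0 <= pi / 2 :> R by lra.
have pi2pi : pi / 2 <= pi :> R by lra.
have mpi (z : R) : 0 <= z -> Num.min z (pi / 2) \in `[0, pi]%R.
  move=> z0; rewrite in_itv /= le_min ge_min.
  by rewrite z0 pi20 pi2pi orbT.
rewrite ltr_cos ?mpi ?(ltW (le_lt_trans x0 xy)) //.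
by rewrite [Num.min x _]min_l ?(ltW xpi) // lt_min xy.
Qed.

Lemma fucik_profile_decr A B p q s t : 0 < A -> 0 < B -> 0 < p -> 0 < q ->
  0 <= s -> s <= t -> t <= pi ->
  fucik_profile A B p q t <= fucik_profile A B p q s.
Proof.
move=> A0 B0 p0 q0 s0 st tpi; rewrite /fucik_profile lerD // ?lerN2.
  by rewrite ler_pM2l // cos_min_le ?mulr_ge0 ?(ltW p0) // ler_pM2l.
by rewrite ler_pM2l // cos_min_le ?mulr_ge0 ?(ltW q0) ?subr_ge0 // ler_pM2l // lerD2l lerN2.
Qed.

(** At least one term is strictly monotone to the left of pi / 2. If q < 1, the second cosine is
    still active at pi / 2; otherwise p <= 1, and the first is active on all of [0, pi / 2[. *)
Lemma fucik_profile_decr_strict A B p q s : 0 < A -> 0 < B -> 0 < p -> 0 < q ->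
  p^-1 + q^-1 = 2 -> 0 <= s -> s < pi / 2 ->
  fucik_profile A B p q (pi / 2) < fucik_profile A B p q s.
Proof.
move=> A0 B0 p0 q0 pq2 s0 s2; rewrite /fucik_profile; have pi0 := pi_gt0 R.
have pqE : p + q = 2 * (p * q).
  by rewrite -pq2; field; rewrite !gt_eqF.
have half : pi - pi / 2 = pi / 2 :> R by field.
have [q1|q1] := ltP q 1.
  apply: ler_ltD; first by rewrite ler_pM2l // cos_min_le ?mulr_ge0 ?(ltW p0) // ler_pM2l // ltW.
  rewrite ltrN2 ltr_pM2l // half cos_min_lt ?mulr_ge0 ?(ltW q0) //.
  - lra.
  - by rewrite ltr_pM2l //; lra.
  - by rewrite gtr_pMl // divr_gt0.
have p1 : p <= 1 by nra.
apply: ltr_leD; last first.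
  rewrite lerN2 ler_pM2l // cos_min_le ?mulr_ge0 ?(ltW q0) ?subr_ge0 ?ler_pM2l //; lra.
rewrite ltr_pM2l // cos_min_lt ?mulr_ge0 ?(ltW p0) ?ltr_pM2l //.
by apply: le_lt_trans s2; rewrite ler_piMl.
Qed.

End profile_facts.

(** * Coordinates of an eigenfunction in the cosine basis *)

Section fucik_basis.
Context (R : realType).
Local Notation mu := (lebesgue_0pi R).
Implicit Types (A B p q a b : R) (u h : R -> R) (F : L2_0pi R).

(** A is u 0 and B is the depth of the first minimum, at pi / n. Both are values of |u| and their
    maximum bounds |u|, so the normalisation of the supremum amounts to max A B = 1. *)
Lemma fucik_eigenfunction_profile (n : nat) a b u : (0 < n)%N ->
  fucik_Gamma n a b -> fucik_eigenfunction n a b u ->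
  let p := Num.sqrt a / n%:R in let q := Num.sqrt b / n%:R in
  exists A B, [/\ [/\ 0 < A, 0 < B & Num.max A B = 1], [/\ 0 < p, 0 < q & A * p = B * q],
    p^-1 + q^-1 = 2 & forall x, 0 <= x <= pi ->
      u x = fucik_profile A B p q (acos (cos (n%:R * x)))].
Proof.
case: n => // m _; set n := m.+1 => -[a0 b0 gam] [sol u0 supu] p q.
have N0 : (0 : R) < n%:R by rewrite ltr0n.
have pi0 := pi_gt0 R.
have ra0 : 0 < Num.sqrt a by rewrite sqrtr_gt0.
have rb0 : 0 < Num.sqrt b by rewrite sqrtr_gt0.
have p0 : 0 < p by rewrite divr_gt0.
have q0 : 0 < q by rewrite divr_gt0.
have pq2 : p^-1 + q^-1 = 2.
  apply: (@mulfI _ (pi / 2)); first by rewrite gt_eqF // divr_gt0.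
  rewrite [RHS]divfK // -[RHS]gam /p /q.
  by field; rewrite !gt_eqF.
have rab : pi / 2 / Num.sqrt a + pi / 2 / Num.sqrt b = pi / n%:R.
  by rewrite -[X in _ = X / _]gam; field; rewrite !gt_eqF.
have uE := fucik_solution_profile (ltn0Sn m) (esym (sqr_sqrtr (ltW a0)))
  (esym (sqr_sqrtr (ltW b0))) ra0 rb0 rab sol u0.
pose A := u 0; pose B := u 0 * Num.sqrt a / Num.sqrt b.
have B0 : 0 < B by rewrite divr_gt0 ?mulr_gt0.
have ApBq : A * p = B * q by rewrite /A /B /p /q; field; rewrite !gt_eqF.
exists A, B; split=> //; split=> //.
have pi2 : 0 < pi / 2 :> R by rewrite divr_gt0.
(* Shows p >= 1 / 2, so that the capped argument of the first cosine is pi / 2 at s = pi and only -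
   B remains. *)
have pE : p = 2^-1 + p / q / 2.
  have -> : p / q = 2 * p - 1 by rewrite -[2](pq2); field; rewrite !gt_eqF.
  by field.
have acos_cos (x : R) : 0 <= acos (cos x) <= pi.
  have c1 : -1 <= cos x <= 1 by rewrite cos_geN1 cos_le1.
  by rewrite acos_ge0 ?acos_lepi.
set E := [set _ | _ in _] in supu.
have Ebound y : E y -> y <= Num.max A B.
  move=> [x]; rewrite /= in_itv /= => xpi <-; rewrite uE //.
  apply: fucik_profile_bound; rewrite ?acos_cos //; exact: ltW.
have EA : E A.
  exists 0; first by rewrite /= in_itv /= lexx ltW.
  by rewrite gtr0_norm.
have EB : E B.
  exists (pi / n%:R).
    by rewrite /= in_itv /= divr_ge0 ?ler_pdivrMr ?ler_peMr ?ler1n // ltW.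
  rewrite uE; last by rewrite divr_ge0 ?ler_pdivrMr ?ler_peMr ?ler1n // ltW.
  rewrite [n%:R * _]mulrC divfK ?gt_eqF // cosK ?in_itv /= ?lexx ?andbT ?ltW //.
  rewrite /fucik_profile subrr mulr0 [Num.min 0 _]min_l ?(ltW pi2) // cos0.
  rewrite min_r ?cos_pihalf ?mulr0 ?sub0r ?mulr1 ?normrN ?gtr0_norm //.
  rewrite -/p mulrC ler_pM2r // pE lerDl; apply/ltW.
  by rewrite divr_gt0 // divr_gt0.
rewrite -supu; apply/eqP; rewrite eq_le; apply/andP; split.
  have Eub : has_ubound E by exists (Num.max A B).
  by rewrite ge_max !ub_le_sup.
by apply: ge_sup => //; exists A.
Qed.

(** A cosine polynomial close to h (acos (cos t)), taken at t = n x, only has frequencies j n. None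
    of these equals k: j = 0 is excluded by 0 < k, the others by k < n. Cauchy-Schwarz passes to the
    limit. *)
Lemma profile_orthogonal h F (n k : nat) : continuous h -> (0 < k < n)%N ->
  (F : R -> R) = (fun x => h (acos (cos (n%:R * x)))) %[ae mu] ->
  L2dot F (cos_basis R k) = 0.
Proof.
move=> ch /andP[k0 kn] FE; apply/eqP; rewrite -normr_le0.
apply/ler_addgt0Pr => eps eps0; rewrite add0r.
have d0 : 0 < eps / (pi + 1) by rewrite divr_gt0 // addr_gt0 // pi_gt0.
have [f [N [c fE]] hf] := cos_poly_dense ch d0.
pose P : L2_0pi R := \sum_(j < N) (c j / cos_norm R (j * n)) *: cos_basis R (j * n).
have PE : (P : R -> R) = (fun x => f (n%:R * x)) %[ae mu].
  have := @ae_eq_sum _ _ R mu _ (index_enum 'I_N)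
    (fun j : 'I_N => (c j / cos_norm R (j * n)) *: cos_basis R (j * n)) _
    (fun j => ae_eqZ (c j / cos_norm R (j * n)) (cos_basisE R (j * n))).
  apply: filterS => x /(_ I) -> _; rewrite fE; apply: eq_bigr => j _.
  by rewrite mulrA divfK ?gt_eqF ?cos_norm_gt0 // natrM mulrA.
have Pk : L2dot P (cos_basis R k) = 0.
  rewrite L2dotC (dot_sumr (L2dot (mu := mu))) big1 // => j _.
  rewrite (dot_scaler (L2dot (mu := mu))) cos_basis_orthonormal.
  rewrite (_ : (k == j * n)%N = false) ?mulr0 //; apply/eqP => kjn.
  move: k0 kn; rewrite kjn; case: (j : nat) => [|i]; first by rewrite mul0n.
  by move=> _; rewrite mulSn ltnNge leq_addr.
have cfn : continuous (fun x : R => h (acos (cos (n%:R * x))) - f (n%:R * x)).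
  have cn : continuous (fun x : R => n%:R * x).
    by move=> x; apply: cvgM; [exact: cvg_cst|exact: cvg_id].
  move=> x; apply: cvgB.
    apply: (@continuous_comp _ _ _ (fun x : R => n%:R * x) (fun t => h (acos (cos t)))).
      exact: cn.
    exact: continuous_acos_cos.
  apply: (@continuous_comp _ _ _ (fun x : R => n%:R * x) f); first exact: cn.
  by apply: cos_poly_continuous; exists N, c.
have := L2norm_bounded (lebesgue_0pi_fin R) (continuous_measurable_fun cfn)
  (ae_eqB FE PE) (fun x => ltW (hf (n%:R * x))).
rewrite lebesgue_0pi_setT /= => FP.
have FPe : `|F - P| <= eps.
  rewrite -(@ler_pXn2r _ 2) ?nnegrE // ?(ltW eps0) //; apply: (le_trans FP).
  have pi0 := pi_gt0 R; rewrite exprMn exprVn -mulrA ler_piMr ?sqr_ge0 //.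
  have pi1 : 0 < (pi + 1) ^+ 2 :> R by rewrite exprn_gt0 // addr_gt0.
  rewrite mulrC (ler_pdivrMr _ _ pi1) mul1r.
  by move: (pi : R) pi0 => t t0; nra.
have -> : L2dot F (cos_basis R k) = L2dot (F - P) (cos_basis R k).
  by rewrite (dot_subl (L2dot (mu := mu))) /= Pk subr0.
apply: le_trans (dot_cauchy_schwarz (@L2norm_dot _ _ _ mu) _ _) _.
have -> : `|cos_basis R k| = 1.
  apply/eqP; rewrite -(@eqrXn2 _ 2) // expr1n L2norm_dot.
  by rewrite (cos_basis_orthonormal R k k) eqxx.
by rewrite mulr1.
Qed.

(** Subtracting the constant h (pi / 2) leaves the n-th coordinate unchanged, as n > 0. With s =
    acos (cos (n x)), both h s - h (pi / 2) and cos s are nonnegative before pi / 2 and nonpositive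
    after it, so their product is nonnegative. A zero coordinate would make it vanish almost
    everywhere, although it is positive on ]0, pi / (2 n)[. *)
Lemma profile_diagonal A B p q F (n : nat) : (0 < n)%N ->
  0 < A -> 0 < B -> 0 < p -> 0 < q -> p^-1 + q^-1 = 2 ->
  (F : R -> R) = (fun x => fucik_profile A B p q (acos (cos (n%:R * x)))) %[ae mu] ->
  L2dot F (cos_basis R n) != 0.
Proof.
move=> n0 A0 B0 p0 q0 pq2 FE; have pi0 := pi_gt0 R.
have N0 : (0 : R) < n%:R by rewrite ltr0n.
pose g x := fucik_profile A B p q (acos (cos (n%:R * x))).
have cn : continuous (fun x : R => n%:R * x).
  by move=> x; apply: cvgM; [exact: cvg_cst|exact: cvg_id].
have cg : continuous g.
  move=> x; apply: (@continuous_comp _ _ _ (fun x : R => n%:R * x)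
    (fun t => fucik_profile A B p q (acos (cos t)))); first exact: cn.
  by apply: continuous_acos_cos; exact: continuous_fucik_profile.
pose c0 := fucik_profile A B p q (pi / 2).
pose k x := (g x - c0) * cos (n%:R * x).
have ck : continuous k.
  move=> x; apply: cvgM; last exact: continuous_cos_affine.
  by apply: cvgB; [exact: cg|exact: cvg_cst].
have k_ge0 x : 0 <= k x.
  rewrite /k /g; set t := n%:R * x.
  have c1 : -1 <= cos t <= 1 by rewrite cos_geN1 cos_le1.
  have s0 := acos_ge0 c1; have spi := acos_lepi c1.
  rewrite -[X in _ * X](@acosK _ (cos t)) ?in_itv //.
  move: (acos (cos t)) s0 spi => s s0 spi; rewrite /c0.
  have [s2|s2] := leP s (pi / 2).
    apply: mulr_ge0; first by rewrite subr_ge0; apply: fucik_profile_decr => //; lra.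
    by apply: cos_ge0_pihalf; apply/andP; split; lra.
  have -> : cos s = - cos (pi - s) by rewrite cosB cospi sinpi mul0r addr0 mulN1r opprK.
  rewrite mulrN -mulNr; apply: mulr_ge0.
    by rewrite oppr_ge0 subr_le0; apply: fucik_profile_decr => //; lra.
  by apply: cos_ge0_pihalf; apply/andP; split; lra.
have k_gt0 x : 0 < x < pi / (2 * n%:R) -> 0 < k x.
  move=> /andP[x0 xpi]; have nx0 : 0 < n%:R * x by rewrite mulr_gt0.
  have nx2 : n%:R * x < pi / 2.
    by move: xpi; rewrite ltr_pdivlMr ?mulr_gt0 //; lra.
  rewrite /k /g cosK; last by rewrite in_itv /=; apply/andP; split; lra.
  rewrite mulr_gt0 ?subr_gt0 ?fucik_profile_decr_strict ?(ltW nx0) //.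
  by apply: cos_gt0_pihalf; apply/andP; split; lra.
apply/negP => /eqP Fn.
pose G : L2_0pi R := F - (c0 / cos_norm R 0) *: cos_basis R 0.
have GE : (G : R -> R) = (fun x => g x - c0) %[ae mu].
  apply: filterS (ae_eqB FE (ae_eqZ (c0 / cos_norm R 0) (cos_basisE R 0))) => x /[apply] ->.
  by rewrite mul0r cos0 mulr1 divfK // gt_eqF // cos_norm_gt0.
have Gn : L2dot G (cos_basis R n) = 0.
  rewrite (dot_subl (L2dot (mu := mu))) (dot_scalel (L2dot (mu := mu))) /= Fn.
  by rewrite (cos_basis_orthonormal R 0 n) eq_sym gtn_eqF // mulr0 subr0.
have cnk : continuous (fun x => cos_norm R n * k x).
  by move=> x; apply: cvgM; [exact: cvg_cst|exact: ck].
have mk := continuous_measurable_fun cnk.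
have FF : Filter (nbhs (almost_everywhere mu)) := ae_filter_ringOfSetsType mu.
have GEk : {ae mu, forall x, `|(cos_norm R n * k x)%:E|%E = (G x * cos_basis R n x)%:E}.
  apply: (filterS _ (filterI GE (cos_basisE R n))) => x [/(_ I) -> /(_ I) ->].
  rewrite gee0_abs; last by rewrite lee_fin mulr_ge0 ?k_ge0 // ltW // cos_norm_gt0.
  by congr EFin; rewrite /k; ring.
have ik : (\int[mu]_x `|(cos_norm R n * k x)%:E| = 0)%E.
  transitivity (\int[mu]_x (G x * cos_basis R n x)%:E)%E; last first.
    rewrite -[LHS]fineK; first by rewrite [fine _]Gn.
    exact: (integrable_fin_num _ (L2dot_integrable G (cos_basis R n))).
  apply: ae_eq_integral => //.
  - by apply: measurableT_comp => //; apply/measurable_EFinP.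
  - exact: (measurable_int mu (L2dot_integrable G (cos_basis R n))).
  - by apply: filterS GEk => x ->.
have mk' : measurable_fun setT (fun x => (cos_norm R n * k x)%:E).
  exact/measurable_EFinP.
have [N [mN N0' kN]] := (ae_eq_integral_abs mu measurableT mk').1 ik.
have w0 : 0 < pi / (2 * n%:R) :> R by rewrite divr_gt0 // mulr_gt0.
(* This interval would lie in the null set N, yet its length is positive. *)
have : (mu `]0%R, (pi / (2 * n%:R))%R[%classic <= mu N)%E.
  apply: le_measure; rewrite ?inE // => x /=; rewrite in_itv /= => xw.
  apply: kN => /= /(_ I) -[] ck0.
  have : 0 < cos_norm R n * k x by rewrite mulr_gt0 ?cos_norm_gt0 // k_gt0.
  by rewrite ck0 ltxx.
rewrite N0' /lebesgue_0pi /= /mrestr.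
rewrite (_ : _ `&` _ = `]0%R, (pi / (2 * n%:R))%R[%classic); last first.
  apply/setIidl => x /=; rewrite !in_itv /= => /andP[-> xw] /=.
  rewrite (lt_le_trans xw) // ler_pdivrMr ?mulr_gt0 // ler_peMr ?(ltW pi0) //.
  by rewrite -natrM ler1n muln_gt0.
by rewrite lebesgue_measure_itv /= lte_fin w0 -EFinB subr0 lee_fin leNgt w0.
Qed.

(** For n > 0, sqrt (pi / 2) e_n is cos (n x), so the uniform bound of [fucik_profile_close] is
    squared and multiplied by the length pi. *)
Lemma profile_close A B p q F (n : nat) : (0 < n)%N -> 0 < A -> 0 < B ->
  0 < p -> 0 < q -> Num.max A B = 1 -> A * p = B * q -> p^-1 + q^-1 = 2 ->
  (F : R -> R) = (fun x => fucik_profile A B p q (acos (cos (n%:R * x)))) %[ae mu] ->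
  `|F - Num.sqrt (pi / 2) *: cos_basis R n| ^+ 2 <=
    ((2 + 2 * pi) * (Num.max p q - 1)) ^+ 2 * pi.
Proof.
move=> n0 A0 B0 p0 q0 AB ApBq pq2 FE.
have cE : ((Num.sqrt (pi / 2) *: cos_basis R n : L2_0pi R) : R -> R) =
    (fun x => cos (n%:R * x)) %[ae mu].
  apply: filterS (ae_eqZ (Num.sqrt (pi / 2)) (cos_basisE R n)) => x /(_ I) -> _.
  rewrite mulrA /cos_norm gtn_eqF // -sqrtrM ?divr_ge0 ?pi_ge0 //.
  rewrite mulf_div [2 * pi]mulrC divff ?sqrtr1 ?mul1r //.
  by rewrite mulf_neq0 // gt_eqF // pi_gt0.
have cn : continuous (fun x : R => n%:R * x).
  by move=> x; apply: cvgM; [exact: cvg_cst|exact: cvg_id].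
have := L2norm_bounded (lebesgue_0pi_fin R) _ (ae_eqB FE cE).
rewrite lebesgue_0pi_setT /=; apply.
  apply: continuous_measurable_fun => x; apply: cvgB; last exact: continuous_cos_affine.
  apply: (@continuous_comp _ _ _ (fun x : R => n%:R * x)
    (fun t => fucik_profile A B p q (acos (cos t)))); first exact: cn.
  by apply: continuous_acos_cos; exact: continuous_fucik_profile.
move=> x; set t := n%:R * x.
have c1 : -1 <= cos t <= 1 by rewrite cos_geN1 cos_le1.
rewrite -[in X in _ - X](@acosK _ (cos t)) ?in_itv //.
by apply: fucik_profile_close => //; rewrite acos_ge0 ?acos_lepi.
Qed.

End fucik_basis.

Theorem theorem1p5 (R : realType) (alpha beta : nat -> R)
    (F : nat -> L2_0pi R) :
  fucik_system alpha beta F ->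
  (\sum_(1 <= n <oo)
     ((Num.max (Num.sqrt (alpha n)) (Num.sqrt (beta n)) - n%:R) ^+ 2
      / n%:R ^+ 2)%:E < +oo)%E ->
  riesz_basis (L2dot (mu := lebesgue_0pi R)) F.
Proof.
move=> [_ _ Gam Feig]; pose t n : R :=
  (Num.max (Num.sqrt (alpha n)) (Num.sqrt (beta n)) - n%:R) ^+ 2 / n%:R ^+ 2.
rewrite -[X in (X < _)%E]/(\sum_(1 <= n <oo) (t n)%:E)%E => sum_t.
have pi0 := pi_gt0 R.
have FF : Filter (nbhs (almost_everywhere (lebesgue_0pi R))).
  exact: ae_filter_ringOfSetsType.
have inside : {ae lebesgue_0pi R, forall x, 0 < x < pi} by exact: ae_0pi.
have shape n : (0 < n)%N -> exists A B p q,
    [/\ [/\ 0 < A, 0 < B & Num.max A B = 1], [/\ 0 < p, 0 < q & A * p = B * q],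
      p^-1 + q^-1 = 2, t n = (Num.max p q - 1) ^+ 2 &
      (F n : R -> R) = (fun x => fucik_profile A B p q (acos (cos (n%:R * x))))
        %[ae lebesgue_0pi R]].
  move=> n0; have [u ueig Fu] := Feig n.
  have N0 : (0 : R) < n%:R by rewrite ltr0n.
  have [A [B [AB pq pq2 uE]]] := fucik_eigenfunction_profile n0 (Gam n n0) ueig.
  exists A, B, (Num.sqrt (alpha n) / n%:R), (Num.sqrt (beta n) / n%:R); split=> //.
    rewrite /t -expr_div_n mulrBl divff ?gt_eqF //.
    by rewrite maxr_pMl ?invr_ge0 ?ltW.
  apply: filterS2 Fu inside => x /(_ I) -> /andP[x0 xpi] _.
  by rewrite uE // !ltW.
have c0 : 0 < Num.sqrt (pi / 2 : R) by rewrite sqrtr_gt0 divr_gt0.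
(* The value sqrt 2 / 2 of f^0 equals sqrt (pi / 2) / sqrt pi, so the scalar that fits the cosines
   also fits index 0 exactly. *)
have F0 : F 0%N = Num.sqrt (pi / 2) *: cos_basis R 0.
  have [u u0 Fu] := Feig 0%N; apply/Lspace_eqP.
  apply: (filterS _ (filterI (filterI Fu inside)
    (ae_eqZ (Num.sqrt (pi / 2)) (cos_basisE R 0)))).
  move=> x [[/(_ I) -> /andP[x0 xpi]] /(_ I) ->] _.
  rewrite u0; last by rewrite in_itv /= !ltW.
  rewrite mul0r cos0 mulr1 /cos_norm eqxx sqrtrM ?ltW // mulrAC divff ?mul1r; last first.
    by rewrite gt_eqF // sqrtr_gt0.
  have s2 : 0 < Num.sqrt (2 : R) by rewrite sqrtr_gt0.
  by rewrite sqrtrV // -{2}(sqr_sqrtr (ler0n R 2)) expr2 invfM mulrA divff ?mul1r ?gt_eqF.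
apply: (riesz_basis_triangular (@L2norm_dot _ _ _ _) _ (lt0r_neq0 c0)
  (cos_basis_orthonormal R) (cos_basis_complete R)).
- exact: L2_absolutely_cvg (lebesgue_0pi_fin R).
- move=> n k /andP[k0 kn]; have [A [B [p [q [_ _ _ _ FE]]]]] := shape n (ltn_trans k0 kn).
  exact: (profile_orthogonal (@continuous_fucik_profile R A B p q)
    (introT andP (conj k0 kn)) FE).
- move=> n n0; have [A [B [p [q [[A0 B0 _] [p0 q0 _] pq2 _ FE]]]]] := shape n n0.
  exact: profile_diagonal FE.
- exact: F0.
pose C := (2 + 2 * pi : R) ^+ 2 * pi.
have C0 : 0 <= C by rewrite mulr_ge0 ?sqr_ge0 ?ltW.
have t0 n : 0 <= t n by rewrite divr_ge0 ?sqr_ge0.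
have Ft n : (0 < n)%N -> `|F n - Num.sqrt (pi / 2) *: cos_basis R n| ^+ 2 <= C * t n.
  move=> n0; have [A [B [p [q [[A0 B0 AB] [p0 q0 Apq] pq2 -> FE]]]]] := shape n n0.
  apply: le_trans (profile_close n0 A0 B0 p0 q0 AB Apq pq2 FE) _.
  by rewrite exprMn /C mulrAC.
apply: nondecreasing_is_cvgn; first by apply: nondecreasing_series => n _ _; exact: sqr_ge0.
exists (C * fine (\sum_(1 <= n <oo) (t n)%:E)%E) => _ [n _ <-].
rewrite /series /=; case: n => [|n].
  by rewrite big_geq // mulr_ge0 // fine_ge0 // nneseries_ge0 // => k _ _; rewrite lee_fin.
(* The sum in the hypothesis starts at 1; the term of index 0 vanishes by [F0]. *)
rewrite big_ltn // F0 subrr normr0 expr0n add0r.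
apply: (@le_trans _ _ (\sum_(1 <= i < n.+1) C * t i)).
  by rewrite !big_nat; apply: ler_sum => i /andP[i1 _]; exact: Ft.
rewrite -mulr_sumr ler_wpM2l // -lee_fin fineK; last first.
  by rewrite ge0_fin_numE // nneseries_ge0 // => k _ _; rewrite lee_fin.
rewrite -sumEFin; apply: nneseries_lim_ge => k _ _; rewrite lee_fin.
exact: t0.
Qed.
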